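(* For every integer $p \geq 1$, there exists a pair $\mathcal{B}=\{B_0,B_1\}$ of real square matrices of dimension $2^p(2^{p+1}-1)$ such that: (i) if $x \in \Sigma_2^\omega$ is very weakly extremal for $\mathcal{B}$, then \[P(x,n) \geq \left(\left\lfloor \frac{n}{2^p}\right\rfloor+1\right)^p > 2^{-p^2}n^p\] for every integer $n \geq 1$; (ii) there exists $z \in \Sigma_2^\omega$ which is strongly extremal for $\mathcal{B}$ and satisfies $P(z,n) \leq 2^p\left(\left\lceil \frac{n}{2^p}\right\rceil +2\right)^p$ for every integer $n\ge 1$.
   Context: For an integer $m\ge 1$, $\Sigma_m=\{0,1,\ldots,m-1\}$ and $\Sigma_m^\omega$ is the set of infinite sequences $x=x_1x_2\cdots$ with $x_i\in\Sigma_m$. A subword of $x$ of length $n$ is a word $x_{k+1}x_{k+2}\cdots x_{k+n}$ for some $k\ge 0$; the subword complexity $P(x,n)$ is the number of distinct subwords of $x$ of length $n$. For a finite set $\mathcal{A}=\{A_0,\ldots,A_{m-1}\}$ of $d\times d$ real matrices, its joint spectral radius is $\varrho(\mathcal{A})=\lim_{n\to\infty}\max\{\|A_{i_1}\cdots A_{i_n}\|^{1/n}: i_j\in\Sigma_m\}$, where $\|\cdot\|$ is the Euclidean operator norm. A sequence $x\in\Sigma_m^\omega$ is strongly extremal for $\mathcal{A}$ if there exists $\delta>0$ with $\|A_{x_n}\cdots A_{x_1}\|\ge \delta\varrho(\mathcal{A})^n$ for all $n\ge1$; it is very weakly extremal for $\mathcal{A}$ if $\limsup_{n\to\infty}\|A_{x_n}\cdots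 A_{x_1}\|^{1/n}=\varrho(\mathcal{A})$. *)

(* Defs.v *)
From HB Require Import structures.
From mathcomp Require Import all_boot all_order all_algebra.
From mathcomp Require Import all_classical all_reals all_analysis.
From mathcomp Require Import Rstruct Rstruct_topology.
Set Implicit Arguments. Unset Strict Implicit. Unset Printing Implicit Defensive.
Import Order.TTheory GRing.Theory Num.Theory.
Import numFieldNormedType.Exports.
Local Open Scope classical_set_scope.
Local Open Scope ring_scope.

(* Sigma_m^omega: infinite sequences x_1 x_2 ... ; we index from 0, i.e. [x k] is x_{k+1}. *)
Definition infseq (m : nat) := nat -> 'I_m.

Definition vnorm (d : nat) (v : 'cV[Rdefinitions.R]_d) : Rdefinitions.R := Num.sqrt (\sum_(i < d) v i ord0 ^+ 2).

Definition opnorm (d : nat) (A : 'M[Rdefinitions.R]_d) : Rdefinitions.R :=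
  sup [set vnorm (A *m v) | v in [set v : 'cV[Rdefinitions.R]_d | vnorm v <= 1]].

Fixpoint prodw (m d : nat) (A : 'I_m -> 'M[Rdefinitions.R]_d) (w : nat -> 'I_m) (n : nat) : 'M[Rdefinitions.R]_d :=
  match n with
  | 0 => 1%:M
  | n'.+1 => A (w n') *m prodw A w n'
  end.

Definition prods (m d : nat) (A : 'I_m -> 'M[Rdefinitions.R]_d) (s : seq 'I_m) : 'M[Rdefinitions.R]_d :=
  foldr (fun i M => A i *m M) 1%:M s.

Definition jsr_term (m d : nat) (A : 'I_m -> 'M[Rdefinitions.R]_d) (n : nat) : Rdefinitions.R :=
  \big[Num.max/0]_(w : n.-tuple 'I_m) (opnorm (prods A w) `^ (n%:R^-1)).

Definition jsr (m d : nat) (A : 'I_m -> 'M[Rdefinitions.R]_d) : Rdefinitions.R := limn (jsr_term A).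

Definition strongly_extremal (m d : nat) (A : 'I_m -> 'M[Rdefinitions.R]_d) (x : infseq m) : Prop :=
  exists2 delta : Rdefinitions.R, 0 < delta &
    forall n : nat, (1 <= n)%N -> delta * jsr A ^+ n <= opnorm (prodw A x n).

Definition very_weakly_extremal (m d : nat) (A : 'I_m -> 'M[Rdefinitions.R]_d) (x : infseq m) : Prop :=
  limn_esup (fun n : nat => (opnorm (prodw A x n) `^ (n%:R^-1))%:E) = (jsr A)%:E.

Definition subword_complexity (m : nat) (x : infseq m) (n : nat) : nat :=
  #|[set w : n.-tuple 'I_m | `[< exists k : nat, forall i : 'I_n, tnth w i = x (k + i)%N >]]|.

Definition ceil_div (m d : nat) : nat := (m + d.-1) %/ d.

(* Main.v *)
(* The two shears U(x,y) = (x+y,y) and L(x,y) = (x,x+y), with positive weights, have a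
   Barabanov norm N on the positive cone: N v = max (N (Uv)) (N (Lv)) up to the weights.
   Since N is monotone, U is optimal at v and L at v' only if the slope y/x of v' is at
   most that of v; hence comparing two optimal orbits shows that optimal words are balanced with
   a common frequency. The weights (e^-a, e^-b) whose products stay bounded form a closed
   convex region; if (a, b) minimises (1-r)a + rb on it, the frequency of the letter L is
   exactly r, for otherwise a small tilt of (a, b) would lower the minimum. So every r in
   (0,1) is the slope of the extremal words of some pair.
   Taking p pairs with rationally independent slopes (ratios of logarithms of primes), the
   tensor product of the pairs is driven by p independent Sturmian words: by Kronecker's
   theorem all combinations of their factors occur in every long optimal word. The p words
   are interleaved into one binary word, read cyclically in time modulo 2^p; the remaining
   2^p - p times of a period only admit the letter 0. *)
Require Import Defs.
From HB Require Import structures.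
From mathcomp Require Import all_boot all_order all_algebra.
From mathcomp Require Import all_classical all_reals all_analysis.
From mathcomp Require Import Rstruct Rstruct_topology.
From mathcomp Require Import ring lra zify.
Import Order.TTheory GRing.Theory Num.Theory.
Import numFieldNormedType.Exports.
Local Open Scope ring_scope.

Set Implicit Arguments.
Unset Strict Implicit.
Unset Printing Implicit Defensive.

(** * Products of weighted shears *)

(** A very weakly extremal sequence may fail to be optimal at many steps, so the facts about optimal
    words need a bridge to the limsup. The bridge is a compactness dichotomy: for fixed [K] there is
    one [q < 1] such that a word of [K + 1] letters either ends in [K] letters that are optimal from
    some interior vector, or multiplies N by at most [q] on the whole cone. In the tensor product
    the contraction of a single track suffices, because the other tracks never expand. So if no
    block of [K + 1] periods has all p tracks optimal at once, the norms decay exponentially and the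
    limsup falls below the joint spectral radius, which is 1. One good block is therefore
    guaranteed, and one is enough: Kronecker's theorem supplies [K] uniformly in the phases of the
    tracks, hence before the sequence is known. The same dichotomy drives the calibration of the
    frequency: over long blocks a tilt makes optimal words lose weight and, being small, cannot undo
    the contraction of the others. *)

Lemma expr_unbounded (R : realType) (g C : R) : 1 < g -> exists j, C < g ^+ j.
Proof.
move=> g1; have B j : 1 + (g - 1) *+ j <= g ^+ j.
  elim: j => [|j IH]; first by rewrite mulr0n addr0 expr0.
  rewrite exprS mulrSr.
  have : 0 <= (g - 1) *+ j by apply: mulrn_wge0; rewrite subr_ge0 ltW.
  move: IH g1; set a := _ *+ j; set b := g ^+ j; nra.
have g0 : 0 < g - 1 by rewrite subr_gt0.
exists (Num.truncn (`|C| / (g - 1))).+1.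
apply: lt_le_trans (B _).
have := truncnS_gt (`|C| / (g - 1)).
rewrite ltr_pdivrMr // mulr_natl => h; apply: (le_lt_trans (ler_norm C)); lra.
Qed.

Lemma expr_small (R : realType) (q e : R) : 0 <= q -> q < 1 -> 0 < e -> exists j, q ^+ j < e.
Proof.
rewrite le_eqVlt => /predU1P[<- _ e0|q0 q1 e0]; first by exists 1%N; rewrite expr1.
have [|j H] := @expr_unbounded R q^-1 e^-1; first by rewrite invf_gt1.
by exists j; move: H; rewrite exprVn ltf_pV2 // posrE // exprn_gt0.
Qed.

Section Growth.
Variable R : realType.
Implicit Types (v u : R * R) (w : bool -> R) (f g : R * R -> R) (x : nat -> bool).

Definition cone v := (0 <= v.1) && (0 <= v.2).
Definition interior v := (0 < v.1) && (0 < v.2).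
Definition mass v := v.1 + v.2.

(** The letter [false] is the shear U, the letter [true] is L. *)
Definition shear (b : bool) v : R * R :=
  if b then (v.1, v.1 + v.2) else (v.1 + v.2, v.2).

Arguments shear : simpl never.

(** Maximum of weight times final value of [f] over all words of length n; the recursion peels off
    the first letter, whereas [orbit] peels off the last. *)
Fixpoint growth f w n v : R :=
  if n is n'.+1 then
    Num.max (w false * growth f w n' (shear false v))
            (w true * growth f w n' (shear true v))
  else f v.

Fixpoint orbit x v n : R * R :=
  if n is n'.+1 then shear (x n') (orbit x v n') else v.

Definition weight w x n : R := \prod_(i < n) w (x i).

Definition monotone f := forall a b c d : R, 0 <= a -> 0 <= b -> a <= c -> b <= d ->
  f (a, b) <= f (c, d).
Definition homogeneous f := forall c x y : R, 0 <= c -> 0 <= x -> 0 <= y ->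
  f (c * x, c * y) = c * f (x, y).
Definition subadditive f := forall a b c d : R, 0 <= a -> 0 <= b -> 0 <= c -> 0 <= d ->
  f (a + c, b + d) <= f (a, b) + f (c, d).
Definition positive_weights w := forall b, 0 < w b.

Lemma shear_cone b v : cone v -> cone (shear b v).
Proof. by case: b; case: v => x y /andP[/= ? ?]; rewrite /cone /shear /=; apply/andP; split=> //; lra. Qed.

Lemma shear_interior b v : interior v -> interior (shear b v).
Proof. by case: b; case: v => x y /andP[/= ? ?]; rewrite /interior /shear /=; apply/andP; split=> //; lra. Qed.

Lemma interior_cone v : interior v -> cone v.
Proof. by move=> /andP[/ltW a /ltW b]; rewrite /cone a b. Qed.

Lemma orbit_cone x v n : cone v -> cone (orbit x v n).
Proof. by move=> cv; elim: n => //= n; apply: shear_cone. Qed.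

Lemma orbit_interior x v n : interior v -> interior (orbit x v n).
Proof. by move=> cv; elim: n => //= n; apply: shear_interior. Qed.

Lemma orbitS x v n : orbit x v n.+1 = orbit (fun k => x k.+1) (shear (x 0%N) v) n.
Proof. by elim: n => //= n ->. Qed.

Lemma orbitD x v m n : orbit x v (m + n) = orbit (fun k => x (m + k)%N) (orbit x v m) n.
Proof. by elim: n => [|n IH]; rewrite ?addn0 // addnS /= IH. Qed.

Lemma orbit_ext x x' v n : (forall k, (k < n)%N -> x k = x' k) -> orbit x v n = orbit x' v n.
Proof.
by elim: n => //= n IH H; rewrite H // IH // => k kn; rewrite H // ltnW.
Qed.

Lemma weightS w x n : weight w x n.+1 = w (x 0%N) * weight w (fun k => x k.+1) n.
Proof. by rewrite /weight big_ord_recl. Qed.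

Lemma weightSr w x n : weight w x n.+1 = weight w x n * w (x n).
Proof. by rewrite /weight big_ord_recr. Qed.

Lemma weight0 w x : weight w x 0 = 1.
Proof. by rewrite /weight big_ord0. Qed.

Lemma weightD w x m n : weight w x (m + n) = weight w x m * weight w (fun k => x (m + k)%N) n.
Proof. by rewrite /weight big_split_ord. Qed.

Lemma weight_ext w x x' n : (forall k, (k < n)%N -> x k = x' k) -> weight w x n = weight w x' n.
Proof. by move=> H; apply: eq_bigr => i _; rewrite H. Qed.

Lemma weight_gt0 w x n : positive_weights w -> 0 < weight w x n.
Proof. by move=> w0; apply: prodr_gt0. Qed.

Lemma growth_word f w n v : exists x, growth f w n v = weight w x n * f (orbit x v n).
Proof.
elim: n v => [|n IH] v; first by exists xpred0; rewrite weight0 mul1r.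
have H b : exists x, w b * growth f w n (shear b v) = weight w x n.+1 * f (orbit x v n.+1).
  have [x ->] := IH (shear b v).
  by exists (fun k => if k is k'.+1 then x k' else b); rewrite weightS orbitS /= mulrA.
by rewrite /=; case: leP.
Qed.

Lemma growth_ge_word f w x n v : positive_weights w -> weight w x n * f (orbit x v n) <= growth f w n v.
Proof.
move=> w0; elim: n x v => [|n IH] x v; first by rewrite weight0 mul1r.
rewrite weightS orbitS /= -mulrA le_max.
by case: (x 0%N); rewrite !(ler_pM2l (w0 _)) IH ?orbT.
Qed.

Lemma growthD f w m n v : growth f w (m + n) v = growth (growth f w m) w n v.
Proof. by elim: n v => [|n IH] v; rewrite ?addn0 // addnS /= !IH. Qed.

Lemma growth_le f g w n v : positive_weights w -> cone v ->
  (forall u, cone u -> f u <= g u) -> growth f w n v <= growth g w n v.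
Proof.
move=> w0 cv H; elim: n v cv => [|n IH] v cv /=; first exact: H.
rewrite ge_max !le_max; apply/andP; split; apply/orP; [left|right];
  by rewrite (ler_pM2l (w0 _)) IH // shear_cone.
Qed.

Lemma growth_scale f w c n v : 0 <= c -> growth (fun u => c * f u) w n v = c * growth f w n v.
Proof.
move=> c0; elim: n v => //= n IH v.
by rewrite maxr_pMr // !IH !(mulrCA c).
Qed.

Lemma growth_ge0 f w n v : positive_weights w -> (forall u, cone u -> 0 <= f u) -> cone v ->
  0 <= growth f w n v.
Proof.
move=> w0 H; elim: n v => [|n IH] v cv /=; first exact: H.
by rewrite le_max mulr_ge0 //; [exact: ltW | exact/IH/shear_cone].
Qed.

Lemma growth_homogeneous f w n : homogeneous f -> homogeneous (growth f w n).
Proof.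
move=> H; elim: n => [//|n IH] c x y c0 x0 y0 /=.
rewrite /shear /= -!mulrDr !IH ?addr_ge0 // maxr_pMr //.
by rewrite !(mulrCA c).
Qed.

Lemma growth_monotone f w n : positive_weights w -> monotone f -> monotone (growth f w n).
Proof.
move=> w0 H; elim: n => [//|n IH] a b c d a0 b0 ac bd /=.
rewrite ge_max !le_max; apply/andP; split; apply/orP; [left|right];
  rewrite (ler_pM2l (w0 _)); apply: IH => //=; lra.
Qed.

Lemma growth_subadditive f w n : positive_weights w -> subadditive f -> subadditive (growth f w n).
Proof.
move=> w0 H; elim: n => [//|n IH] a b c d a0 b0 c0 d0 /=.
have F (z : bool) : w z * growth f w n (shear z (a + c, b + d)) <=
    w z * growth f w n (shear z (a, b)) + w z * growth f w n (shear z (c, d)).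
  rewrite -mulrDr (ler_pM2l (w0 _)).
  have H1 : 0 <= a + b by lra.
  have H2 : 0 <= c + d by lra.
  case: z; rewrite /shear /= addrACA; exact: IH.
rewrite ge_max; apply/andP; split; (apply: le_trans; first exact: F);
  by apply: lerD; rewrite le_max lexx ?orbT.
Qed.
End Growth.
Arguments shear : simpl never.

(** * The Barabanov norm *)

Section Norm.
Variables (R : realType) (w : bool -> R).
Implicit Types (v u : R * R) (x : nat -> bool).
Hypothesis w0 : positive_weights w.

Definition max_growth (n : nat) v : R := growth (@mass R) w n v.
Definition unit2 : R * R := (1, 1).
(** Boundedness of all weighted products, written as countably many closed conditions on the weights
    with an explicit constant, so that the admissible region is closed. [bounded_admissible] gives
    the converse. *)
Definition admissible := forall n, w false * w true * max_growth n unit2 <= 1.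

Lemma unit_interior : interior unit2.
Proof. by rewrite /interior /= ltr01. Qed.

Lemma unit_cone : cone unit2.
Proof. exact/interior_cone/unit_interior. Qed.

Lemma mass_monotone : monotone (@mass R).
Proof. by move=> a b c d _ _ ac bd; rewrite /mass /=; lra. Qed.

Lemma mass_homogeneous : homogeneous (@mass R).
Proof. by move=> c x y _ _ _; rewrite /mass /= mulrDr. Qed.

Lemma mass_subadditive : subadditive (@mass R).
Proof. by move=> a b c d _ _ _ _; rewrite /mass /=; lra. Qed.

Lemma mass_ge0 v : cone v -> 0 <= mass v.
Proof. by case/andP; rewrite /mass; lra. Qed.

Lemma max_growth_monotone n : monotone (max_growth n).
Proof. exact: growth_monotone mass_monotone. Qed.

Lemma max_growth_homogeneous n : homogeneous (max_growth n).
Proof. exact: growth_homogeneous mass_homogeneous. Qed.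

Lemma max_growth_subadditive n : subadditive (max_growth n).
Proof. exact: growth_subadditive mass_subadditive. Qed.

Lemma max_growth_ge0 n v : cone v -> 0 <= max_growth n v.
Proof. exact: growth_ge0 mass_ge0. Qed.

Lemma max_growth_le_mass n v : cone v -> max_growth n v <= max_growth n unit2 * mass v.
Proof.
case: v => x y /andP[/= x0 y0].
have E := @max_growth_homogeneous n (x + y) 1 1 (addr_ge0 x0 y0) ler01 ler01.
rewrite mulrC /mass /= -E; apply: max_growth_monotone => //; lra.
Qed.

Lemma max_growth_submul m n v : cone v -> max_growth (m + n) v <= max_growth m unit2 * max_growth n v.
Proof.
move=> cv; rewrite /max_growth growthD -growth_scale; last exact: (max_growth_ge0 _ unit_cone).
by apply: growth_le => // u cu; exact: max_growth_le_mass.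
Qed.

(** The word L then U sends v = (x, y) to (2x + y, x + y), which dominates [mass v] times (1, 1). It
    serves to connect any two words at a bounded cost. *)
Lemma max_growth_connect n v : cone v -> w false * w true * mass v * max_growth n unit2 <= max_growth n.+2 v.
Proof.
case: v => x y /andP[/= x0 y0].
have s0 : 0 <= x + y by exact: addr_ge0.
have H : (x + y) * max_growth n unit2 <= max_growth n (shear false (shear true (x, y))).
  rewrite -(max_growth_homogeneous n s0 ler01 ler01) /shear /=.
  apply: max_growth_monotone => /=; lra.
rewrite /max_growth [growth _ _ n.+2 _]/= le_max; apply/orP; right.
rewrite (mulrC (w false)) -!mulrA (ler_pM2l (w0 _)) le_max; apply/orP; left.
by rewrite (ler_pM2l (w0 _)).
Qed.

Lemma max_growth_supermul m n v : cone v ->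
  w false * w true * max_growth m unit2 * max_growth n v <= max_growth (m + 2 + n) v.
Proof.
move=> cv; rewrite /max_growth growthD -growth_scale; last first.
  by rewrite !mulr_ge0 ?(ltW (w0 _)) // (max_growth_ge0 _ unit_cone).
apply: growth_le => // u cu; rewrite mulrAC addn2; exact: max_growth_connect.
Qed.

(** If some g = [w false * w true * max_growth n unit2] exceeded 1, joining copies of the best word
    of length n by the connecting word would give growth at least g^j for every j. *)
Lemma bounded_admissible C : (forall n, max_growth n unit2 <= C) -> admissible.
Proof.
move=> bd n; rewrite leNgt; apply/negP.
set g := _ * _ => g1.
have H j : exists m, g ^+ j <= max_growth m unit2.
  elim: j => [|j [m IH]].
    by exists 0%N; rewrite /max_growth /= /mass expr0 /=; lra.
  exists (n + 2 + m)%N; apply: le_trans (max_growth_supermul _ _ unit_cone).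
  rewrite exprS; apply: ler_pM => //.
    by apply: ltW; apply: lt_trans g1.
  by apply: exprn_ge0; apply: ltW; apply: lt_trans g1.
have [j] := expr_unbounded C g1.
by have [m /le_trans/(_ (bd m))] := H j; lra.
Qed.

Hypothesis adm : admissible.
Hypothesis Tge1 : forall n, 1 <= max_growth n unit2.

Definition coupling : R := w false * w true.

Lemma coupling_gt0 : 0 < coupling. Proof. exact: mulr_gt0. Qed.

Lemma max_growth_unit_le n : max_growth n unit2 <= coupling^-1.
Proof. by rewrite -[_^-1]mul1r ler_pdivlMr ?coupling_gt0 // mulrC. Qed.

Lemma max_growth_le n v : cone v -> max_growth n v <= coupling^-1 * mass v.
Proof.
move=> cv; apply: (le_trans (max_growth_le_mass n cv)).
by apply: ler_wpM2r (max_growth_unit_le n); exact: mass_ge0.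
Qed.

Lemma max_growth_ge n v : cone v -> coupling * mass v <= max_growth n.+2 v.
Proof.
move=> cv; apply: le_trans (max_growth_connect n cv); rewrite -/coupling.
by apply: ler_peMr => //; rewrite mulr_ge0 ?mass_ge0 // ltW // coupling_gt0.
Qed.

Definition eventual_bounds v := [set c : R | exists n, forall k, (n <= k)%N -> max_growth k v <= c]%classic.

(* The limsup of max_growth n v, as the infimum of its eventual upper bounds: a Barabanov norm. *)
Definition lim_growth v : R := inf (eventual_bounds v).
Local Notation N := lim_growth.

Lemma lim_growth_has_inf v : cone v -> has_inf (eventual_bounds v).
Proof.
move=> cv; split; first by exists (coupling^-1 * mass v); exists 0%N => k _; exact: max_growth_le.
by exists 0 => c [n /(_ n (leqnn _))]; apply: le_trans; exact: max_growth_ge0.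
Qed.

Lemma lim_growth_le v c n : cone v -> (forall k, (n <= k)%N -> max_growth k v <= c) -> N v <= c.
Proof. by move=> cv H; apply: ge_inf; [case: (lim_growth_has_inf cv) | exists n]. Qed.

Lemma lim_growth_lt v c : cone v -> N v < c -> exists n, forall k, (n <= k)%N -> max_growth k v <= c.
Proof.
move=> cv /(inf_lt (lim_growth_has_inf cv).1)[c' [n H] c'c].
by exists n => k nk; apply: le_trans (H _ nk) (ltW c'c).
Qed.

Lemma lim_growth_upper v : cone v -> N v <= coupling^-1 * mass v.
Proof. by move=> cv; apply: (@lim_growth_le _ _ 0%N) => // k _; exact: max_growth_le. Qed.

Lemma lim_growth_lower v : cone v -> coupling * mass v <= N v.
Proof.
move=> cv; apply: lb_le_inf; first by case: (lim_growth_has_inf cv).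
move=> c [n /(_ n.+2)]; rewrite (leq_trans _ (leqnSn _)) // => /(_ isT).
by apply: le_trans; exact: max_growth_ge.
Qed.

Lemma lim_growth_monotone : monotone N.
Proof.
move=> a b c d a0 b0 ac bd.
have c1 : cone (a, b) by rewrite /cone /= a0.
have c2 : cone (c, d) by rewrite /cone /= (le_trans a0) ?(le_trans b0).
apply/ler_addgt0Pr => e e0.
have [|n H] := @lim_growth_lt (c, d) (N (c, d) + e) c2; first lra.
apply: (@lim_growth_le _ _ n) => // k nk; apply: le_trans (H k nk).
exact: max_growth_monotone.
Qed.

Lemma lim_growth_subadditive : subadditive N.
Proof.
move=> a b c d a0 b0 c0 d0.
have c1 : cone (a, b) by rewrite /cone /= a0.
have c2 : cone (c, d) by rewrite /cone /= c0.
have c3 : cone (a + c, b + d) by rewrite /cone /= !addr_ge0.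
apply/ler_addgt0Pr => e e0.
have [|n H] := @lim_growth_lt (c, d) (N (c, d) + e / 2) c2; first lra.
have [|m K] := @lim_growth_lt (a, b) (N (a, b) + e / 2) c1; first lra.
apply: (@lim_growth_le _ _ (maxn n m)) => // k; rewrite geq_max => /andP[nk mk].
apply: (le_trans (max_growth_subadditive _ a0 b0 c0 d0)).
by have := H k nk; have := K k mk; lra.
Qed.

Lemma lim_growth_homogeneous : homogeneous N.
Proof.
have aux (c x y : R) : 0 < c -> 0 <= x -> 0 <= y -> N (c * x, c * y) <= c * N (x, y).
  move=> c0 x0 y0.
  have c1 : cone (x, y) by rewrite /cone /= x0.
  have c2 : cone (c * x, c * y) by rewrite /cone /= !mulr_ge0 // ltW.
  apply/ler_addgt0Pr => e e0.
  have [|n H] := @lim_growth_lt (x, y) (N (x, y) + e / c) c1; first by rewrite ltrDl divr_gt0.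
  apply: (@lim_growth_le _ _ n) => // k nk.
  rewrite (max_growth_homogeneous _ (ltW c0) x0 y0).
  have := H k nk; rewrite -(ler_pM2l c0) mulrDr mulrCA mulfV ?mulr1 //; exact: lt0r_neq0.
move=> c p q; rewrite le_eqVlt => /predU1P[<- p0 q0|c0 p0 q0].
  rewrite !mul0r; apply/eqP; rewrite eq_le.
  have c0 : cone (0 : R, 0 : R) by rewrite /cone /= lexx.
  have := lim_growth_upper c0; have := lim_growth_lower c0; rewrite /mass /= addr0 !mulr0.
  by move=> -> ->.
apply/eqP; rewrite eq_le aux //=.
have ci : 0 < c^-1 by rewrite invr_gt0.
have := aux _ (c * p) (c * q) ci (mulr_ge0 (ltW c0) p0) (mulr_ge0 (ltW c0) q0).
by rewrite !mulrA mulVf ?lt0r_neq0 // !mul1r ler_pdivlMl.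
Qed.

Lemma lim_growth_step_le b v : cone v -> w b * N (shear b v) <= N v.
Proof.
move=> cv; have cb := shear_cone b cv.
apply/ler_addgt0Pr => e e0.
have [|n H] := @lim_growth_lt v (N v + e) cv; first lra.
have K : N (shear b v) <= (N v + e) / w b.
  apply: (@lim_growth_le _ _ n) => // k nk.
  rewrite ler_pdivlMr // mulrC.
  have := H k.+1; rewrite (leq_trans nk) // => /(_ isT); apply: le_trans.
  by rewrite /max_growth /= le_max; case: b {cb} => /=; rewrite lexx ?orbT.
by move: K; rewrite ler_pdivlMr // mulrC.
Qed.

(** The Barabanov equation. A limsup, unlike a supremum over all n, is unchanged when n is shifted
    by one, and the limsup of the maximum of two sequences is the maximum of their limsups. *)
Lemma lim_growth_step_max v : cone v ->
  N v = Num.max (w false * N (shear false v)) (w true * N (shear true v)).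
Proof.
move=> cv; apply/eqP; rewrite eq_le ge_max !lim_growth_step_le // !andbT.
apply/ler_addgt0Pr => e e0.
have D b : exists n, forall k, (n <= k)%N -> w b * max_growth k (shear b v) <= w b * N (shear b v) + e.
  have [|n H] := @lim_growth_lt (shear b v) (N (shear b v) + e / w b) (shear_cone b cv).
    by rewrite ltrDl divr_gt0.
  exists n => k nk; have := H k nk.
  by rewrite -(ler_pM2l (w0 b)) mulrDr mulrCA mulfV ?mulr1 // lt0r_neq0.
have [n H] := D false; have [m K] := D true.
apply: (@lim_growth_le _ _ (maxn n m).+1) => // -[//|k].
rewrite ltnS geq_max => /andP[nk mk]; rewrite /max_growth /= ge_max.
apply/andP; split.
  by apply: (le_trans (H k nk)); rewrite lerD2r le_max lexx.
by apply: (le_trans (K k mk)); rewrite lerD2r le_max lexx orbT.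
Qed.

Lemma lim_growth_step_attained v : cone v -> exists b, w b * N (shear b v) = N v.
Proof.
move=> cv; have := lim_growth_step_max cv; case: leP => _ ->; first by exists true.
by exists false.
Qed.

Lemma lim_growth_word_le x v n : cone v -> weight w x n * N (orbit x v n) <= N v.
Proof.
move=> cv; elim: n => [|n IH]; first by rewrite weight0 mul1r.
apply: le_trans IH; rewrite weightSr -mulrA ler_pM2l ?weight_gt0 //.
exact/lim_growth_step_le/orbit_cone.
Qed.
End Norm.

(** * Optimal words are balanced *)

Section Extremal.
Variables (R : realType) (w : bool -> R).
Implicit Types (v u : R * R) (x : nat -> bool).
Hypothesis w0 : positive_weights w.
Hypothesis adm : admissible w.
Hypothesis Tge1 : forall n, 1 <= max_growth w n (unit2 R).
Local Notation N := (lim_growth w).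

Definition ones x n : nat := \sum_(i < n) x i.
Definition shift m x : nat -> bool := fun k => x (m + k)%N.
(** The first n letters of x are optimal from v: no step loses norm. The starting vector is interior
    so that the strict sign comparisons of [cross] hold along the orbit. *)
Definition ext v x n := interior v /\ weight w x n * N (orbit x v n) = N v.
Definition cross v u : R := v.1 * u.2 - u.1 * v.2.

Lemma ones0 x : ones x 0 = 0%N. Proof. by rewrite /ones big_ord0. Qed.

Lemma onesS x n : ones x n.+1 = (ones x n + x n)%N.
Proof. by rewrite /ones big_ord_recr. Qed.

Lemma onesD x m n : ones x (m + n) = (ones x m + ones (shift m x) n)%N.
Proof. by rewrite /ones big_split_ord. Qed.

Lemma interiorP v : interior v -> cone v /\ 0 < N v.
Proof.
move=> iv; have cv := interior_cone iv; split=> //.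
apply: lt_le_trans (lim_growth_lower w0 adm Tge1 cv).
by rewrite mulr_gt0 ?coupling_gt0 //; case/andP: iv; rewrite /mass; lra.
Qed.

(** Powers of a single shear grow linearly, so with a weight of at least 1 they would be
    unbounded. *)
Lemma weight_lt1 b : w b < 1.
Proof.
have O n : orbit (fun=> b) (unit2 R) n =
    if b then (1, 1 + n%:R) else (1 + n%:R, 1).
  elim: n => [|n /= ->]; first by rewrite /= !addr0 /unit2; case: b.
  by case: b; rewrite /shear /= -natr1; congr pair; lra.
have B n : w b ^+ n * n.+2%:R <= max_growth w n (unit2 R).
  apply: le_trans (growth_ge_word _ (fun=> b) _ _ w0).
  rewrite O /weight prodr_const card_ord ler_pM2l ?exprn_gt0 //.
  by rewrite -!natr1 /mass; case: b {O} => /=; lra.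
rewrite ltNge; apply/negP => b1.
have k0 : 0 < coupling w by apply: mulr_gt0.
pose n := Num.truncn (coupling w)^-1.
have h1 : (coupling w)^-1 < n.+2%:R by apply: (lt_trans (truncnS_gt _)); rewrite ltr_nat.
have h2 : n.+2%:R <= (coupling w)^-1.
  apply: le_trans (max_growth_unit_le w0 adm n); apply: le_trans (B n).
  by rewrite ler_peMl // exprn_ege1.
lra.
Qed.

Lemma lim_growth_lower_shear (k : nat) (a b : R) : 0 <= a -> 0 <= b ->
  w true ^+ k * N (a, a *+ k + b) <= N (a, b).
Proof.
move=> a0 b0; elim: k => [|k IH]; first by rewrite mul1r mulr0n add0r.
apply: le_trans IH; rewrite exprSr -mulrA ler_pM2l ?exprn_gt0 //.
have c : cone (a, a *+ k + b) by rewrite /cone /= a0 addr_ge0 ?mulrn_wge0.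
by have := lim_growth_step_le w0 adm true c; rewrite /shear /= mulrS addrA.
Qed.

(** An optimal word cannot consist of L forever. After 2k letters L the vector is at most twice the
    one after k letters, so optimality would give z <= 2 w^k z for z = [N (a, b)] and w = [w true],
    while w^k < 1/2 for large k. *)
Lemma exists_upper_step (a b : R) : 0 <= a -> 0 <= b -> 0 < a + b ->
  exists k, w true ^+ k * (w false * N (a *+ k.+1 + b, a *+ k + b)) = N (a, b).
Proof.
move=> a0 b0 ab; apply: contrapT => H.
have cb k : cone (a, a *+ k + b) by rewrite /cone /= a0 addr_ge0 ?mulrn_wge0.
have E k : w true ^+ k * N (a, a *+ k + b) = N (a, b).
  elim: k => [|k IH]; first by rewrite mul1r mulr0n add0r.
  have [[]] := lim_growth_step_attained w0 adm (cb k).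
    by rewrite /shear /= exprSr -mulrA mulrS -addrA => ->.
  by rewrite /shear /= addrA -mulrS => h; case: H; exists k; rewrite h.
have N0 : 0 < N (a, b).
  apply: lt_le_trans (lim_growth_lower w0 adm Tge1 _); last by rewrite /cone /= a0.
  by rewrite mulr_gt0 ?coupling_gt0.
have [k hk] : exists k, w true ^+ k < 2^-1.
  by apply: expr_small; rewrite ?ltW ?weight_lt1 // ?invr_gt0 ?ltr0n.
have D : N (a, a *+ (k + k) + b) <= 2 * N (a, a *+ k + b).
  rewrite -lim_growth_homogeneous ?ler0n //; last by rewrite addr_ge0 ?mulrn_wge0.
  by apply: lim_growth_monotone => //; rewrite ?mulrnDr ?addr_ge0 ?mulrn_wge0 //; lra.
have k0 : 0 < w true ^+ k by apply: exprn_gt0.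
have := E (k + k)%N; have := E k; move: D k0 hk N0.
rewrite exprD; set p := w true ^+ k; set x := N (a, _ + b); set y := N (a, _ + b).
set z := N (a, b); move=> D k0 hk N0 Ek Ekk.
have : z <= p * (2 * z) by rewrite -{1}Ekk -{1}Ek -mulrA ler_pM2l // mulrCA ler_pM2l.
nra.
Qed.

(* Along an optimal word containing both letters the second basis vector acquires
   positive coordinates, so increasing it increases the norm strictly. *)
Lemma lim_growth_strict (a b d : R) : 0 <= a -> 0 <= b -> 0 < a + b -> b < d -> N (a, b) < N (a, d).
Proof.
move=> a0 b0 ab bd.
have [k E] := exists_upper_step a0 b0 ab.
have d0 : 0 <= d by lra.
set M := a *+ k.+1 + b; set m := a *+ k + b.
have kp : 0 <= a *+ k by apply: mulrn_wge0.
(* After L^k U both coordinates [M] and [m] gain d - b when b is raised to d; this dominates scaling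
   by a factor t > 1, to which homogeneity applies. *)
have m0 : 0 <= m by rewrite addr_ge0.
have mM : m <= M by rewrite /m /M mulrS; lra.
pose t := 1 + (d - b) / (M + 1).
have M1 : 0 < M + 1 by lra.
have t1 : 1 < t by rewrite ltrDl divr_gt0 // subr_gt0.
have tM : t * M <= M + (d - b).
  rewrite mulrDl mul1r lerD2l mulrAC ler_pdivrMr // ler_wpM2l //; lra.
have tm : t * m <= m + (d - b).
  rewrite mulrDl mul1r lerD2l mulrAC ler_pdivrMr // ler_wpM2l //; lra.
have h1 : N (t * M, t * m) <= N (a *+ k.+1 + d, a *+ k + d).
  apply: lim_growth_monotone => //; rewrite ?mulr_ge0 //; try lra.
    by move: tM; rewrite /M; lra.
  by move: tm; rewrite /m; lra.
rewrite lim_growth_homogeneous // in h1; [|lra|lra].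
have h2 : w true ^+ k * (w false * N (a *+ k.+1 + d, a *+ k + d)) <= N (a, d).
  apply: le_trans (lim_growth_lower_shear k a0 d0); rewrite ler_pM2l ?exprn_gt0 //.
  have c : cone (a, a *+ k + d) by rewrite /cone /= a0 addr_ge0.
  by have := lim_growth_step_le w0 adm false c; rewrite /shear /= addrA -mulrS.
have N0 : 0 < N (a, b).
  apply: lt_le_trans (lim_growth_lower w0 adm Tge1 _); last by rewrite /cone /= a0.
  by rewrite mulr_gt0 ?coupling_gt0.
apply: (@lt_le_trans _ _ (t * N (a, b))); first by rewrite ltr_pMl.
apply: le_trans h2; rewrite -E !(mulrCA t) ler_pM2l ?exprn_gt0 // ler_pM2l //.
Qed.

(** With e = y / (x + y), the value [N (1, e)] after U increases strictly in e, while the value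
    [N (1 - e, 1)] after L does not increase. Hence U optimal at e and L optimal at some e' > e
    contradict each other. *)
Lemma allowed_cross v u : interior v -> interior u ->
  w false * N (shear false v) = N v -> w true * N (shear true u) = N u -> cross v u <= 0.
Proof.
case: v => x y; case: u => x' y' iv iu Ev Eu.
have [cv _] := interiorP iv; have [cu _] := interiorP iu.
have := lim_growth_step_le w0 adm true cv; have := lim_growth_step_le w0 adm false cu.
rewrite -Ev -Eu /shear /=.
move: iv iu; rewrite /interior /cross /= => /andP[x0 y0] /andP[x0' y0'].
have s0 : 0 < x + y by lra.
have s0' : 0 < x' + y' by lra.
pose e := y / (x + y); pose e' := y' / (x' + y').
have e0 : 0 < e by rewrite divr_gt0.
have e0' : 0 < e' by rewrite divr_gt0.
have Ey : y = (x + y) * e by rewrite mulrCA mulfV ?mulr1 ?lt0r_neq0.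
have Ey' : y' = (x' + y') * e' by rewrite mulrCA mulfV ?mulr1 ?lt0r_neq0.
have Ex : x = (x + y) * (1 - e) by rewrite mulrBr mulr1 -Ey; lra.
have Ex' : x' = (x' + y') * (1 - e') by rewrite mulrBr mulr1 -Ey'; lra.
have e1 : 0 < 1 - e by rewrite subr_gt0 ltr_pdivrMr //; lra.
have e1' : 0 < 1 - e' by rewrite subr_gt0 ltr_pdivrMr //; lra.
have P (s f : R) : 0 < s -> 0 < f -> N (s, s * f) = s * N (1, f).
  by move=> p q; rewrite -lim_growth_homogeneous ?ltW ?mulr1.
have Q (s f : R) : 0 < s -> 0 < f -> N (s * f, s) = s * N (f, 1).
  by move=> p q; rewrite -lim_growth_homogeneous ?ltW ?mulr1.
have -> : N (x + y, y) = (x + y) * N (1, e) by rewrite -P // -Ey.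
have -> : N (x, x + y) = (x + y) * N (1 - e, 1) by rewrite -Q // -Ex.
have -> : N (x' + y', y') = (x' + y') * N (1, e') by rewrite -P // -Ey'.
have -> : N (x', x' + y') = (x' + y') * N (1 - e', 1) by rewrite -Q // -Ex'.
rewrite !(mulrCA (w _)) !ler_pM2l // => h1 h2.
have [le_e|lt_e] := leP e' e.
  rewrite subr_le0; move: le_e; rewrite ler_pdivrMr // mulrAC ler_pdivlMr //; lra.
have h3 : N (1, e) < N (1, e') by apply: lim_growth_strict; lra.
have h4 : N (1 - e', 1) <= N (1 - e, 1) by apply: lim_growth_monotone => //; lra.
move: h3 h4; rewrite -(ltr_pM2l (w0 false)) -(ler_pM2l (w0 true)); lra.
Qed.

Lemma ext_split v x m n : ext v x (m + n) -> ext v x m /\ ext (orbit x v m) (shift m x) n.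
Proof.
move=> [iv]; have [cv _] := interiorP iv.
have io := orbit_interior x m iv; have [co _] := interiorP io.
rewrite weightD orbitD -/(shift m x) -mulrA => E.
have h1 := lim_growth_word_le w0 adm x m cv.
have h2 := lim_growth_word_le w0 adm (shift m x) n co.
have E1 : weight w x m * N (orbit x v m) = N v.
  apply/eqP; rewrite eq_le h1 -{1}E ler_pM2l ?weight_gt0 //.
split; split=> //; move: E; rewrite -E1 => /mulfI; apply.
by rewrite lt0r_neq0 // weight_gt0.
Qed.

Lemma ext_allowed v x n k : ext v x n -> (k < n)%N ->
  w (x k) * N (shear (x k) (orbit x v k)) = N (orbit x v k).
Proof.
move=> e kn; move: e; rewrite -(subnKC kn) => /ext_split[+ _].
by rewrite -addn1 => /ext_split[_ [_]]; rewrite /weight big_ord1 /= /shift addn0.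
Qed.

Lemma ext_prefix v x m n : (m <= n)%N -> ext v x n -> ext v x m.
Proof. by move=> mn; rewrite -(subnKC mn) => /ext_split[]. Qed.

(** Stronger than balance: the same word leads at every prefix, by at most one. This turns the
    windows of an optimal word into a chain, on which the upper bound for the complexity rests. *)
Definition ahead x x' n := forall k, (k <= n)%N -> (ones x k <= ones x' k <= (ones x k).+1)%N.

Lemma aheadS x x' n : ahead x x' n ->
  (ones x n.+1 <= ones x' n.+1 <= (ones x n.+1).+1)%N -> ahead x x' n.+1.
Proof.
by move=> a h k; rewrite leq_eqVlt => /predU1P[->//|]; rewrite ltnS; apply: a.
Qed.

(* [cross v v' < 0] compares the ratios [v.1 / v.2]; each letter preserves the order of
   the ratios, and two different letters exchange it while changing the counts by one. *)
Lemma ext_chain_aux v v' x x' n : ext v x n -> ext v' x' n ->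
  [\/ (forall k, (k <= n)%N -> ones x k = ones x' k) /\ cross (orbit x v n) (orbit x' v' n) = 0,
      ahead x x' n /\ ((ones x' n = ones x n /\ cross (orbit x v n) (orbit x' v' n) < 0) \/
                       (ones x' n = (ones x n).+1 /\ 0 < cross (orbit x v n) (orbit x' v' n))) |
      ahead x' x n /\ ((ones x n = ones x' n /\ 0 < cross (orbit x v n) (orbit x' v' n)) \/
                       (ones x n = (ones x' n).+1 /\ cross (orbit x v n) (orbit x' v' n) < 0))].
Proof.
elim: n => [|n IH] e e'.
  have A y y' : ahead y y' 0 by move=> [|//] _; rewrite !ones0.
  have [c|c|c] := ltgtP (cross v v') 0; [apply: Or32|apply: Or33|apply: Or31];
    split=> //; rewrite ?ones0; first by left.
    by left.
  by move=> [|//]; rewrite !ones0.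
have al := ext_allowed e (ltnSn n); have al' := ext_allowed e' (ltnSn n).
have {}IH := IH (ext_prefix (leqnSn n) e) (ext_prefix (leqnSn n) e').
have iu := orbit_interior x n e.1; have iu' := orbit_interior x' n e'.1.
move: IH al al'; rewrite [orbit x v n.+1]/= [orbit x' v' n.+1]/=.
set u := orbit x v n in iu *; set u' := orbit x' v' n in iu' *.
have same b : cross (shear b u) (shear b u') = cross u u'.
  by rewrite /cross /shear; case: b => /=; lra.
(* U and L map the open cone to opposite sides of the diagonal, so after different letters the sign
   does not depend on u and u'. *)
have up : 0 < cross (shear false u) (shear true u').
  move: iu iu'; rewrite /interior /cross /shear /= => /andP[? ?] /andP[? ?]; nra.
have down : cross (shear true u) (shear false u') < 0.
  move: iu iu'; rewrite /interior /cross /shear /= => /andP[? ?] /andP[? ?]; nra.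
have cs : cross u' u = - cross u u' by rewrite /cross; lra.
have := @onesS x n; have := @onesS x' n.
case: (x n); case: (x' n); rewrite ?same ?addn0 ?addn1 => o' o.
- case=> [[E c] _ _|[A c] _ _|[A c] _ _].
  + apply: Or31; split=> // k; rewrite leq_eqVlt => /predU1P[->|]; last exact: E.
    by rewrite o o' E.
  + apply: Or32; split; last by case: c => -[h c]; [left|right]; split=> //; lia.
    by apply: aheadS => //; case: c => -[h _]; lia.
  + apply: Or33; split; last by case: c => -[h c]; [left|right]; split=> //; lia.
    by apply: aheadS => //; case: c => -[h _]; lia.
- case=> [[E c] al al'|[A [[h c]|[h c]]] al al'|[A [[h c]|[h c]]] al al'].
  + apply: Or33; split; last by right; rewrite o o' E.
    by apply: aheadS; [move=> k kn; rewrite E // leqnn leqnSn | rewrite o o' E // leqnn leqnSn].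
  + by have := allowed_cross iu' iu al' al; lra.
  + apply: Or32; split; last by left; split=> //; lia.
    by apply: aheadS => //; lia.
  + apply: Or33; split; last by right; split=> //; lia.
    by apply: aheadS => //; lia.
  + by have := allowed_cross iu' iu al' al; lra.
- case=> [[E c] al al'|[A [[h c]|[h c]]] al al'|[A [[h c]|[h c]]] al al'].
  + apply: Or32; split; last by right; rewrite o o' E.
    by apply: aheadS; [move=> k kn; rewrite E // leqnn leqnSn | rewrite o o' E // leqnn leqnSn].
  + apply: Or32; split; last by right; split=> //; lia.
    by apply: aheadS => //; lia.
  + by have := allowed_cross iu iu' al al'; lra.
  + by have := allowed_cross iu iu' al al'; lra.
  + apply: Or33; split; last by left; split=> //; lia.
    by apply: aheadS => //; lia.
- case=> [[E c] _ _|[A c] _ _|[A c] _ _].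
  + apply: Or31; split=> // k; rewrite leq_eqVlt => /predU1P[->|]; last exact: E.
    by rewrite o o' E.
  + apply: Or32; split; last by case: c => -[h c]; [left|right]; split=> //; lia.
    by apply: aheadS => //; case: c => -[h _]; lia.
  + apply: Or33; split; last by case: c => -[h c]; [left|right]; split=> //; lia.
    by apply: aheadS => //; case: c => -[h _]; lia.
Qed.

Lemma ext_chain v v' x x' n : ext v x n -> ext v' x' n -> ahead x x' n \/ ahead x' x n.
Proof.
move=> e e'; case: (ext_chain_aux e e') => [[E _]|[A _]|[A _]]; [left|by left|by right].
by move=> k /E ->; rewrite leqnn leqnSn.
Qed.

Lemma ext_infinite : exists x, forall n, ext (unit2 R) x n.
Proof.
pose g v := w false * N (shear false v) != N v.
pose st n := iter n (fun v => shear (g v) v) (unit2 R).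
exists (fun n => g (st n)) => n; split; first exact: unit_interior.
have O k : orbit (fun n => g (st n)) (unit2 R) k = st k by elim: k => //= k ->.
elim: n => [|n IH]; first by rewrite weight0 mul1r.
rewrite weightSr -mulrA [orbit _ _ _]/= O -[RHS]IH O; congr (_ * _).
have c : cone (st n) by rewrite -O; apply/orbit_cone/unit_cone.
rewrite /g; case: eqP => //= h.
by have [[]] := lim_growth_step_attained w0 adm c.
Qed.

(** Up to one, every optimal word of length n has as many ones as each window of length n of a fixed
    infinite optimal word z. Cutting the prefix of z of length mn into m or into n windows gives
    [cmp]: every (ones - 1) / n is at most every (ones + 1) / m. The frequency is the supremum of
    the former. *)
Lemma ext_frequency : exists r : R, forall v x n, ext v x n ->
  `|(ones x n)%:R - n%:R * r| <= 1.
Proof.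
have [z Hz] := ext_infinite.
have win v x n k : ext v x n ->
    (ones x n <= (ones (shift k z) n).+1)%N /\ (ones (shift k z) n <= (ones x n).+1)%N.
  move=> e; have e' : ext (orbit z (unit2 R) k) (shift k z) n.
    by have /ext_split[] := Hz (k + n)%N.
  by case: (ext_chain e e') => /(_ n (leqnn _)); lia.
have cmp v x n v' x' m : ext v x n -> ext v' x' m ->
    (m * ones x n <= n * (ones x' m).+1 + m)%N.
  move=> e e'.
  have h1 k : (k * ones x n <= ones z (k * n) + k)%N.
    elim: k => // k IH; rewrite !mulSnr onesD; have [h _] := win _ _ _ (k * n)%N e; lia.
  have h2 k : (ones z (k * m) <= k * (ones x' m).+1)%N.
    elim: k => [|k IH]; first by rewrite ones0.
    by rewrite !mulSnr onesD; have [_ h] := win _ _ _ (k * m)%N e'; lia.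
  by have := h1 m; have := h2 n; rewrite mulnC; lia.
pose F := [set s : R | exists v x n, [/\ ext v x n, (0 < n)%N & s = ((ones x n)%:R - 1) / n%:R]]%classic.
have ub v x m : ext v x m -> (0 < m)%N -> ubound F (((ones x m)%:R + 1) / m%:R).
  move=> e m0 s [v' [x' [n [e' n0 ->]]]].
  rewrite ler_pdivrMr ?ltr0n // mulrAC ler_pdivlMr ?ltr0n //.
  have := cmp _ _ _ _ _ _ e' e.
  rewrite -(ler_nat R) natrD !natrM -natr1; lra.
have hs : has_sup F.
  split; first by exists (((ones z 1)%:R - 1) / 1%:R), (unit2 R), z, 1%N.
  by exists (((ones z 1)%:R + 1) / 1%:R); apply: ub (Hz 1%N) _.
exists (sup F) => v x n e.
have [->|n0] := posnP n; first by rewrite ones0 mul0r subr0 normr0 ler01.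
have n1 : 0 < n%:R :> R by rewrite ltr0n.
have h1 : ((ones x n)%:R - 1) / n%:R <= sup F.
  by apply: ub_le_sup; [case: hs | exists v, x, n].
have h2 : sup F <= ((ones x n)%:R + 1) / n%:R.
  by apply: ge_sup; [case: hs | exact: ub e n0].
move: h1 h2; rewrite ler_pdivrMr // ler_pdivlMr // ler_norml => h1 h2.
by apply/andP; split; lra.
Qed.
End Extremal.

(** * Words that are not optimal contract uniformly *)

Section Dichotomy.
Variables (R : realType) (w : bool -> R).
Implicit Types (v u : R * R) (x : nat -> bool).
Hypothesis w0 : positive_weights w.
Hypothesis adm : admissible w.
Hypothesis Tge1 : forall n, 1 <= max_growth w n (unit2 R).
Local Notation N := (lim_growth w).

Lemma lim_growth_diff_le v u : cone v -> cone u ->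
  N v - N u <= (coupling w)^-1 * (`|v.1 - u.1| + `|v.2 - u.2|).
Proof.
case: v => a b; case: u => c d /andP[/= a0 b0] /andP[/= c0 d0].
have H : N (a, b) <= N (c + `|a - c|, d + `|b - d|).
  apply: lim_growth_monotone => //; first by have := ler_norm (a - c); lra.
  by have := ler_norm (b - d); lra.
have cn : cone (`|a - c|, `|b - d|) by rewrite /cone /= !normr_ge0.
have := lim_growth_subadditive w0 adm c0 d0 (normr_ge0 (a - c)) (normr_ge0 (b - d)).
have := lim_growth_upper w0 adm cn; rewrite /mass /=; lra.
Qed.

Lemma lim_growth_comp_continuous (f g : R -> R) : (forall t, cone (f t, g t)) ->
  continuous f -> continuous g -> continuous (fun t => N (f t, g t)).
Proof.
move=> H cf cg t; apply/cvgrPdist_lt => e e0.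
have k0 := coupling_gt0 w0.
have e1 : 0 < coupling w * e / 2 by rewrite divr_gt0 // mulr_gt0.
have /cvgrPdist_lt/(_ _ e1) nf := cf t; have /cvgrPdist_lt/(_ _ e1) ng := cg t.
near=> s.
have h1 : `|f t - f s| < coupling w * e / 2 by near: s.
have h2 : `|g t - g s| < coupling w * e / 2 by near: s.
have h3 : (coupling w)^-1 * (`|f t - f s| + `|g t - g s|) < e.
  by rewrite mulrC ltr_pdivrMr // mulrC; lra.
have d1 := le_lt_trans (lim_growth_diff_le (H t) (H s)) h3.
have d2 : N (f s, g s) - N (f t, g t) < e.
  by apply: le_lt_trans (lim_growth_diff_le (H s) (H t)) _; rewrite /= distrC (distrC (g s)).
by rewrite ltr_norml d1 andbT ltrNl opprB.
Unshelve. all: by end_near. Qed.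

Lemma orbit_scale x (c a b : R) n :
  orbit x (c * a, c * b) n = (c * (orbit x (a, b) n).1, c * (orbit x (a, b) n).2).
Proof.
by elim: n => //= n ->; rewrite /shear /=; case: (x n); rewrite mulrDr.
Qed.

Lemma orbit_continuous x (f g : R -> R) n : continuous f -> continuous g ->
  continuous (fun t => (orbit x (f t, g t) n).1) /\
  continuous (fun t => (orbit x (f t, g t) n).2).
Proof.
move=> cf cg; elim: n => [//|n [IH1 IH2]] /=; rewrite /shear.
by case: (x n) => /=; split=> // t; apply: cvgD; [exact: IH1|exact: IH2|exact: IH1|exact: IH2].
Qed.

Lemma cone_N_gt0 v : cone v -> 0 < mass v -> 0 < N v.
Proof.
move=> cv mv; apply: lt_le_trans (lim_growth_lower w0 adm Tge1 cv).
by rewrite mulr_gt0 ?coupling_gt0.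
Qed.

(* A boundary vector enters the interior after one optimal step, hence the shift. *)
Lemma word_dichotomy x n : (exists v, ext w v (shift 1 x) n) \/
  exists q, [/\ 0 <= q, q < 1 &
    forall v, cone v -> weight w x n.+1 * N (orbit x v n.+1) <= q * N v].
Proof.
(* Clamping t to [0, 1] makes the parametrisation (1 - t, t) of the simplex, and with it the ratio
   [F], continuous on the whole line. *)
pose cl (t : R) := Num.max 0 (Num.min t 1).
have cl01 t : 0 <= cl t <= 1.
  by rewrite /cl; apply/andP; split; [rewrite le_max lexx | rewrite ge_max ler01 ge_min lexx orbT].
have ccl : continuous cl.
  move=> t; apply: (@continuous_max R R (fun=> 0) (fun t => Num.min t 1)); first exact: cvg_cst.
  by apply: (@continuous_min R R id (fun=> 1)); [exact: cvg_id | exact: cvg_cst].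
pose f t := 1 - cl t.
have cf : continuous f by move=> t; apply: cvgB; [exact: cvg_cst|exact: ccl].
have cv t : cone (f t, cl t).
  by have /andP[h1 h2] := cl01 t; rewrite /cone /f /= h1 andbT; lra.
have Np t : 0 < N (f t, cl t) by apply: cone_N_gt0 => //; rewrite /mass /f /=; lra.
pose F t := weight w x n.+1 * N (orbit x (f t, cl t) n.+1) / N (f t, cl t).
have cF : continuous F.
  have [c1 c2] := orbit_continuous x n.+1 cf ccl.
  have co t : cone ((orbit x (f t, cl t) n.+1).1, (orbit x (f t, cl t) n.+1).2).
    by rewrite -surjective_pairing; exact: orbit_cone.
  have cN : continuous (fun t => N (orbit x (f t, cl t) n.+1)).
    have := lim_growth_comp_continuous co c1 c2.
    have -> // : (fun t => N ((orbit x (f t, cl t) n.+1).1, (orbit x (f t, cl t) n.+1).2)) =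
      (fun t => N (orbit x (f t, cl t) n.+1)).
    by apply/funext => s; rewrite -surjective_pairing.
  move=> t; apply: cvgM; last first.
    apply: cvgV; first exact: lt0r_neq0.
    exact: (lim_growth_comp_continuous cv cf ccl).
  apply: cvgM; first exact: cvg_cst.
  exact: cN.
(* By homogeneity the supremum of the contraction ratio over the cone is a maximum over this
   segment. Either it is less than 1 and serves as [q], or it equals 1 and a maximising vector makes
   the word optimal. *)
have [c c01 Fc] : exists2 c, c \in `[0, 1] & forall t, t \in `[0, 1] -> F t <= F c.
  by apply: EVT_max; [exact: ler01 | apply: continuous_subspaceT].
have Fc1 : F c <= 1 by rewrite ler_pdivrMr ?Np // mul1r; exact: lim_growth_word_le.
have [F1|F1] := eqVneq (F c) 1; last first.
  right; exists (F c); split.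
  - rewrite divr_ge0 ?mulr_ge0 ?(ltW (weight_gt0 _ _ _)) // ?(ltW (Np _)) //.
    have := lim_growth_lower w0 adm Tge1 (orbit_cone x n.+1 (cv c)); apply: le_trans.
    by rewrite mulr_ge0 ?(ltW (coupling_gt0 w0)) // mass_ge0 // orbit_cone.
  - by rewrite lt_neqAle F1.
  - move=> [a b] cab; have [a0 b0] : 0 <= a /\ 0 <= b by move/andP: cab.
    have [s0|s0] := leP (a + b) 0.
      have -> : a = 0 by lra.
      have -> : b = 0 by lra.
      have := @orbit_scale x 0 0 0 n.+1; rewrite !mul0r => ->.
      have -> : N (0, 0) = 0 by have := lim_growth_homogeneous w0 adm Tge1 (lexx 0) (lexx 0) (lexx 0); rewrite !mul0r.
      by rewrite !mulr0.
    pose t := b / (a + b).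
    have t01 : 0 <= t <= 1.
      by rewrite /t divr_ge0 ?(ltW s0) //= ler_pdivrMr // mul1r; lra.
    have clt : cl t = t.
      by rewrite /cl; case/andP: t01 => h1 h2; rewrite (min_idPl h2) (max_idPr h1).
    have Eb : b = (a + b) * cl t by rewrite clt mulrCA mulfV ?mulr1 // lt0r_neq0.
    have Ea : a = (a + b) * f t by rewrite /f mulrBr mulr1 -Eb; lra.
    have /andP[q1 q2] := orbit_cone x n.+1 (cv t).
    have /andP[p1 p2] := cv t.
    have h : weight w x n.+1 * N (orbit x (f t, cl t) n.+1) <= F c * N (f t, cl t).
      by rewrite -ler_pdivrMr ?Np //; apply: (Fc t); rewrite in_itv.
    have -> : (a, b) = ((a + b) * f t, (a + b) * cl t) by rewrite -Ea -Eb.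
    rewrite orbit_scale !lim_growth_homogeneous ?(ltW s0) //.
    by rewrite -surjective_pairing !(mulrCA _ (a + b)) ler_pM2l.
left.
have F2 : weight w x n.+1 * N (orbit x (f c, cl c) n.+1) = N (f c, cl c).
  exact: divr1_eq F1.
set v := (f c, cl c) in F2; have cv' : cone v by exact: cv.
exists (orbit x v 1).
have E1 : w (x 0%N) * N (orbit x v 1) = N v.
  apply/eqP; rewrite eq_le lim_growth_step_le //= -{1}F2 -(add1n n) weightD orbitD.
  rewrite /weight big_ord1 -mulrA ler_pM2l //.
  exact/lim_growth_word_le/orbit_cone.
split; last first.
  move: F2; rewrite -(add1n n) weightD orbitD /weight big_ord1 -mulrA -E1 => /mulfI; apply.
  by rewrite lt0r_neq0.
move: E1; rewrite /= /v /interior.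
have := Np c; have := cv c; rewrite /cone /=; set a := f c; set b := cl c.
have ab : a + b = 1 by rewrite /a /f subrK.
move=> /andP[a0 b0] Nab; have w1 := weight_lt1 w0 adm.
(* The first letter misses the interior only if it fixes the boundary vector; optimality would then
   force its weight to be 1. *)
rewrite /shear /=; case: (x 0%N) => /= E.
  have [a1|a1] := ltP 0 a; first by rewrite ab ltr01.
  have a2 : a = 0 by lra.
  move: E Nab; rewrite a2 add0r => E; have := w1 true; nra.
have [b1|b1] := ltP 0 b; first by rewrite ab ltr01.
have b2 : b = 0 by lra.
move: E Nab; rewrite b2 addr0 => E; have := w1 false; nra.
Qed.
End Dichotomy.

(** * Prescribing the frequency *)

Section Minimizer.
Variable R : realType.
Implicit Types (v u : R * R) (x : nat -> bool) (a b r : R).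

Definition expw a b (c : bool) : R := if c then expR (- b) else expR (- a).

Lemma expw_pos a b : positive_weights (expw a b).
Proof. by case; exact: expR_gt0. Qed.

Lemma periodic_bound (f : nat -> R) n : (forall k, 0 <= f k) -> (0 < n)%N ->
  (forall k, f (n + k)%N <= f k) -> forall k, f k <= \sum_(i < n) f i.
Proof.
move=> f0 n0 H; elim/ltn_ind => k IH.
have [kn|nk] := ltnP k n.
  by rewrite (bigD1 (Ordinal kn)) //= lerDl sumr_ge0.
rewrite -(subnKC nk); apply: le_trans (H _) (IH _ _).
by rewrite -subn_gt0 subKn.
Qed.

Lemma max_growth_continuous n v : continuous (fun p : R * R => max_growth (expw p.1 p.2) n v).
Proof.
elim: n v => [|n IH] v p; first exact: cvg_cst.
have step (c : bool) : {for p, continuous (fun p : R * R =>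
    expw p.1 p.2 c * max_growth (expw p.1 p.2) n (shear c v))}.
  apply: cvgM; last exact: IH.
  case: c => /=.
    apply: (@continuous_comp _ _ _ (fun p : R * R => - p.2) expR); last exact: continuous_expR.
    by apply: cvgN; exact: cvg_snd.
  apply: (@continuous_comp _ _ _ (fun p : R * R => - p.1) expR); last exact: continuous_expR.
  by apply: cvgN; exact: cvg_fst.
exact: (@continuous_max R _ _ _ p (step false) (step true)).
Qed.

Lemma admissible_half : admissible (expw (ln 2) (ln 2)).
Proof.
have -> : expw (ln 2) (ln 2) = fun=> 2^-1.
  by apply/funext => c; rewrite /expw; case: c; rewrite expRN lnK // posrE.
move=> n.
have H v : cone v -> max_growth (fun=> 2^-1) n v <= mass v.
  elim: n v => [//|n IH] v cv; rewrite /max_growth /= ge_max.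
  have B c : mass (shear c v) <= 2 * mass v.
    by case/andP: cv; case: c; rewrite /mass /shear /=; lra.
  by apply/andP; split; rewrite ler_pdivrMl //; apply: le_trans (IH _ _) (B _);
    exact: shear_cone.
have := H _ (@unit_cone R); rewrite /mass /=; lra.
Qed.

Lemma admissible_gt0 a b : admissible (expw a b) -> 0 < a /\ 0 < b.
Proof.
move=> adm; have := weight_lt1 (@expw_pos a b) adm.
by move=> H; have := H false; have := H true; rewrite /= !expR_lt1 !oppr_lt0.
Qed.

Lemma exists_minimizer r : 0 < r -> r < 1 -> exists a b, admissible (expw a b) /\
  forall a' b', admissible (expw a' b') -> (1 - r) * a + r * b <= (1 - r) * a' + r * b'.
Proof.
move=> r0 r1.
have l2 : 0 < ln 2 :> R by apply: ln_gt0; rewrite ltr1n.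
pose A := [set p : R * R | admissible (expw p.1 p.2)]%classic.
(* Admissible exponents are positive, and (ln 2, ln 2) is admissible with objective value ln 2. All
   competitors at least as good therefore lie in this box. *)
pose box := (`[0, ln 2 / (1 - r)] `*` `[0, ln 2 / r] : set (R * R))%classic.
have clA : closed A.
  have -> : A = (\bigcap_(n in setT) (fun p : R * R =>
      expw p.1 p.2 false * expw p.1 p.2 true * max_growth (expw p.1 p.2) n (unit2 R)) @^-1` [set y | y <= 1])%classic.
    by apply/seteqP; split => p /= H n; [move=> _|]; exact: H.
  apply: closed_bigI => n _; apply: preimage_closed; last exact: closed_le.
  move=> p _; apply: cvgM; last exact: max_growth_continuous.
  apply: cvgM.
    apply: (@continuous_comp _ _ _ (fun p : R * R => - p.1) expR); last exact: continuous_expR.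
    by apply: cvgN; exact: cvg_fst.
  apply: (@continuous_comp _ _ _ (fun p : R * R => - p.2) expR); last exact: continuous_expR.
  by apply: cvgN; exact: cvg_snd.
have cbox : compact (box `&` A)%classic.
  apply: compact_closedI => //; apply: compact_setX; exact: segment_compact.
have inbox (a b : R) : 0 < a -> 0 < b -> (1 - r) * a + r * b <= ln 2 -> box (a, b).
  move=> a0 b0 h; split => /=; rewrite in_itv /= ltW //= ler_pdivlMr; nra.
have ne : (box `&` A !=set0)%classic.
  exists (ln 2, ln 2); split; last exact: admissible_half.
  by apply: inbox => //; lra.
pose obj (p : R * R) := (1 - r) * p.1 + r * p.2.
have [|[a b]] := @compact_EVT_min _ _ obj _ ne cbox.
  apply: continuous_subspaceT => p; apply: cvgD; apply: cvgM; try exact: cvg_cst.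
    exact: cvg_fst.
  exact: cvg_snd.
rewrite inE => -[_ Aab] min; exists a, b; split=> // a' b' adm.
have [a0 b0] := admissible_gt0 adm.
have [h|h] := leP ((1 - r) * a' + r * b') (ln 2).
  by apply: (min (a', b')); rewrite inE; split=> //; exact: inbox.
have : obj (a, b) <= obj (ln 2, ln 2).
  apply: min; rewrite inE; split; last exact: admissible_half.
  by apply: inbox => //; lra.
by rewrite /obj /=; lra.
Qed.

Lemma growth_weight_scale f (w : bool -> R) c n v : 0 <= c ->
  growth f (fun d => c * w d) n v = c ^+ n * growth f w n v.
Proof.
move=> c0; elim: n v => [|n IH] v; first by rewrite mul1r.
rewrite /= !IH maxr_pMr ?exprn_ge0 // exprS; congr Num.max; ring.
Qed.

(** If the growth t at time n were less than 1, lowering both exponents by e = - ln t / n would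
    raise it to exactly 1. By submultiplicativity the products would stay bounded, at a smaller
    value of the objective. *)
Lemma minimizer_T_ge1 r a b : admissible (expw a b) ->
  (forall a' b', admissible (expw a' b') -> (1 - r) * a + r * b <= (1 - r) * a' + r * b') ->
  forall n, 1 <= max_growth (expw a b) n (unit2 R).
Proof.
move=> adm min n; rewrite leNgt; apply/negP => T1.
have n0 : (0 < n)%N by case: n T1 => //; rewrite /max_growth /= /mass /=; lra.
have T0 : 0 < max_growth (expw a b) n (unit2 R).
  apply: lt_le_trans (growth_ge_word _ xpred0 _ _ (@expw_pos a b)).
  rewrite mulr_gt0 ?weight_gt0 //; first exact: expw_pos.
  by have /andP[] := orbit_interior xpred0 n (@unit_interior R); rewrite /mass; lra.
set t := max_growth _ _ _ in T0 T1.
have n1 : 0 < n%:R :> R by rewrite ltr0n.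
pose e := - ln t / n%:R.
have e0 : 0 < e by rewrite divr_gt0 // oppr_gt0 ln_lt0 // T0.
have Ew : expw (a - e) (b - e) = fun c => expR e * expw a b c.
  by apply/funext => -[]; rewrite /= -exp.expRD; congr expR; lra.
have TE k v : max_growth (expw (a - e) (b - e)) k v = expR e ^+ k * max_growth (expw a b) k v.
  by rewrite /max_growth Ew growth_weight_scale // expR_ge0.
have adm' : admissible (expw (a - e) (b - e)).
  apply: (bounded_admissible (@expw_pos _ _)); apply: (periodic_bound _ n0).
    by move=> k; apply: (max_growth_ge0 (@expw_pos _ _)); exact: unit_cone.
  move=> k; apply: le_trans (max_growth_submul (@expw_pos _ _) _ _ (@unit_cone R)) _.
  rewrite TE -/t.
  have -> : expR e ^+ n * t = 1.
    rewrite -expRM_natr /e divfK ?lt0r_neq0 // expRN lnK ?posrE //.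
    by rewrite mulVf // lt0r_neq0.
  by rewrite mul1r.
have := min _ _ adm'; lra.
Qed.

(** The tilt by h moves (a, b) along a level line of (1 - r) a + r b, and the shift by e lowers this
    objective by e. The effect of the tilt on a word is governed by the deviation of its ones from
    the frequency r. *)
Lemma weight_tilt r a b h e x n :
  weight (expw (a + h * r - e) (b - h * (1 - r) - e)) x n =
  weight (expw a b) x n * expR (h * ((ones x n)%:R - r * n%:R) + e * n%:R).
Proof.
elim: n => [|n IH]; first by rewrite !weight0 ones0 !mulr0 subrr mulr0 add0r exp.expR0 mulr1.
rewrite !weightSr IH onesS -!mulrA; congr (_ * _).
rewrite natrD -natr1.
case: (x n) => /=; rewrite -!exp.expRD; congr expR; lra.
Qed.

(** The dichotomy concerns only the first n + 1 letters, so the maximum over finitely many words is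
    a common [q]. The seed 1/2 of this maximum keeps it positive, since its logarithm is taken
    later. *)
Lemma uniform_dichotomy (w : bool -> R) : positive_weights w -> admissible w ->
  (forall n, 1 <= max_growth w n (unit2 R)) -> forall n,
  exists q, [/\ 0 < q, q < 1 & forall x, (exists v, ext w v (shift 1 x) n) \/
    forall v, cone v -> weight w x n.+1 * lim_growth w (orbit x v n.+1) <= q * lim_growth w v].
Proof.
move=> w0 adm Tge1 n.
pose good x q := 0 <= q /\ q < 1 /\ ((exists v, ext w v (shift 1 x) n) \/
    forall v, cone v -> weight w x n.+1 * lim_growth w (orbit x v n.+1) <= q * lim_growth w v).
have [q Hq] : {q : (n.+1).-tuple bool -> R &
    forall t : (n.+1).-tuple bool, good (nth false t) (q t)}.
  apply: (@choice _ _ (fun t : (n.+1).-tuple bool => good (nth false t))) => t; rewrite /good.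
  have [e|[q [q0 q1 H]]] := word_dichotomy w0 adm Tge1 (nth false t) n.
    by exists 0; split=> //; split; [exact: ltr01 | left].
  by exists q; split=> //; split=> //; right.
pose Q := \big[Num.max/2^-1]_t q t.
have Qt t : q t <= Q by exact: le_bigmax.
exists Q; split.
- by apply: (@lt_le_trans _ _ 2^-1); [rewrite invr_gt0 | exact: bigmax_ge_id].
- by apply/bigmax_ltP; split=> [|t _]; [rewrite invf_lt1 ?ltr1n | case: (Hq t) => _ []].
move=> x; pose t : (n.+1).-tuple bool := [tuple x i | i < n.+1].
have E k : (k < n.+1)%N -> nth false t k = x k.
  by move=> kn; rewrite -(tnth_nth _ _ (Ordinal kn)) tnth_mktuple.
have [_ [_ [[v [iv e]]|H]]] := Hq t; [left; exists v; split=> //|right => v cv].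
  rewrite -(@orbit_ext _ (shift 1 (nth false t))) -?(@weight_ext _ _ (shift 1 (nth false t))) //;
    by move=> k kn; rewrite /shift E.
rewrite -(@orbit_ext _ (nth false t)) // -(@weight_ext _ _ (nth false t)) //.
apply: le_trans (H v cv) _; apply: ler_wpM2r (Qt t).
have := lim_growth_lower w0 adm Tge1 cv; apply: le_trans.
by rewrite mulr_ge0 ?(ltW (coupling_gt0 w0)) // mass_ge0.
Qed.

Lemma ones_le x n : (ones x n <= n)%N.
Proof. by elim: n => [|n IH]; rewrite ?ones0 // onesS; case: (x n); lia. Qed.

Theorem exists_calibrated r : 0 < r -> r < 1 -> exists w : bool -> R,
  [/\ positive_weights w, admissible w, forall n, 1 <= max_growth w n (unit2 R) &
      forall v x n, ext w v x n -> `|(ones x n)%:R - n%:R * r| <= 1].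
Proof.
move=> r0 r1; have [a [b [adm min]]] := exists_minimizer r0 r1.
have w0 := @expw_pos a b; have Tge1 := minimizer_T_ge1 adm min.
have [s Hs] := ext_frequency w0 adm Tge1.
exists (expw a b); split=> //.
suff -> : r = s by [].
apply/eqP/negPn/negP => rs.
pose D := `|s - r|.
have D0 : 0 < D by rewrite normr_gt0 subr_eq0 eq_sym.
(* Over M = K + 1 letters whose last K are optimal, the ones deviate from s M by at most 2 + |s|.
   The drift M |s - r| must outweigh this with one unit to spare, which pays for the shift e M =
   h. *)
pose K := (Num.truncn ((3 + `|s|) / D)).
pose M := K.+1.
have MD : 3 + `|s| <= M%:R * D.
  by rewrite -ler_pdivrMr // ltW // truncnS_gt.
have M0 : 0 < M%:R :> R by rewrite ltr0n.
have [q [q0 q1 Hq]] := uniform_dichotomy w0 adm Tge1 K.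
(* Tilt and shift change a weight over M letters by at most the factor exp(2 M h) = 1/q, so they
   cannot undo a contraction by q. The sign of [eta] below is the one that makes optimal words lose
   weight. *)
pose h := - ln q / (2 * M%:R).
have h0 : 0 < h by rewrite divr_gt0 ?mulr_gt0 // oppr_gt0 ln_lt0 // q0.
pose eta := if s < r then h else - h.
have etaD : eta * (s - r) = - (h * D).
  rewrite /eta /D; case: ltP => c; first by rewrite ltr0_norm ?subr_lt0 //; lra.
  by rewrite ger0_norm ?subr_ge0 //; lra.
have etan : `|eta| = h by rewrite /eta; case: ifP; rewrite ?normrN gtr0_norm.
pose e := h / M%:R.
have e0 : 0 < e by rewrite divr_gt0.
have eM : e * M%:R = h by rewrite divfK // lt0r_neq0.
pose w' := expw (a + eta * r - e) (b - eta * (1 - r) - e).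
have w'0 : positive_weights w' by exact: expw_pos.
(* Blocks of M letters with the tilted weights do not increase the old norm. Hence the tilted
   weights are admissible, against the minimality of (a, b). *)
have con x v : cone v -> weight w' x M * lim_growth (expw a b) (orbit x v M) <= lim_growth (expw a b) v.
  move=> cv; rewrite /w' weight_tilt eM mulrAC.
  have No : 0 <= lim_growth (expw a b) (orbit x v M).
    have := lim_growth_lower w0 adm Tge1 (orbit_cone x M cv); apply: le_trans.
    by rewrite mulr_ge0 ?(ltW (coupling_gt0 w0)) // mass_ge0 // orbit_cone.
  have Nv : 0 <= lim_growth (expw a b) v.
    have := lim_growth_lower w0 adm Tge1 cv; apply: le_trans.
    by rewrite mulr_ge0 ?(ltW (coupling_gt0 w0)) // mass_ge0.
  have WN := lim_growth_word_le w0 adm x M cv.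
  have W0 : 0 <= weight (expw a b) x M * lim_growth (expw a b) (orbit x v M).
    by rewrite mulr_ge0 // ltW // weight_gt0.
  have [[u eu]|nx] := Hq x.
    have := Hs _ _ _ eu.
    set k := ones (shift 1 x) K => hk.
    have ok : (ones x M)%:R = (x 0%N)%:R + k%:R :> R.
      by rewrite -natrD /k /M -(add1n K) onesD onesS ones0.
    have hk2 : `|(ones x M)%:R - s * M%:R| <= 2 + `|s|.
      have -> : (ones x M)%:R - s * M%:R = (k%:R - K%:R * s) + ((x 0%N)%:R - s).
        by rewrite ok /M -natr1; lra.
      apply: le_trans (ler_normD _ _) _.
      have : `|(x 0%N)%:R - s| <= 1 + `|s|.
        apply: le_trans (ler_normB _ _) _; rewrite lerD2r ger0_norm ?ler0n //.
        by case: (x 0%N).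
      by move: hk; lra.
    have ex : eta * ((ones x M)%:R - r * M%:R) + h <= 0.
      have -> : eta * ((ones x M)%:R - r * M%:R) =
          eta * ((ones x M)%:R - s * M%:R) + M%:R * (eta * (s - r)) by lra.
      have h1 : eta * ((ones x M)%:R - s * M%:R) <= h * (2 + `|s|).
        apply: le_trans (ler_norm _) _; rewrite normrM etan.
        by rewrite ler_pM2l.
      rewrite etaD; have : h * (3 + `|s|) <= h * (M%:R * D) by rewrite ler_pM2l.
      by move: h1; lra.
    by apply: le_trans WN; rewrite -[leRHS]mulr1 ler_wpM2l // -[leRHS]exp.expR0 ler_expR.
  have ex : eta * ((ones x M)%:R - r * M%:R) + h <= 2 * M%:R * h.
    have h1 : `|(ones x M)%:R - r * M%:R| <= M%:R.
      have o1 : (ones x M)%:R <= M%:R :> R by rewrite ler_nat ones_le.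
      have o2 : 0 <= (ones x M)%:R :> R by rewrite ler0n.
      have o3 : 0 <= r * M%:R by rewrite mulr_ge0 // ltW.
      have o4 : r * M%:R <= M%:R by rewrite ger_pMl // ltW.
      by rewrite ler_norml; apply/andP; split; lra.
    have h2 : eta * ((ones x M)%:R - r * M%:R) <= h * M%:R.
      apply: le_trans (ler_norm _) _; rewrite normrM etan.
      by rewrite ler_pM2l.
    have : 1 <= M%:R :> R by rewrite ler1n.
    by move: h2; nra.
  have := nx v cv; rewrite -/M => nxM.
  apply: (@le_trans _ _ (q * lim_growth (expw a b) v * expR (2 * M%:R * h))).
    by apply: ler_pM => //; rewrite ?expR_ge0 ?ler_expR.
  have -> : 2 * M%:R * h = - ln q by rewrite /h mulrCA mulfV ?mulr1 // lt0r_neq0 // mulr_gt0.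
  by rewrite expRN lnK ?posrE // mulrAC mulfV ?mul1r // lt0r_neq0.
have gr v : cone v -> growth (lim_growth (expw a b)) w' M v <= lim_growth (expw a b) v.
  by move=> cv; have [x ->] := growth_word (lim_growth (expw a b)) w' M v; exact: con.
have Npos u : cone u -> 0 <= lim_growth (expw a b) u.
  move=> cu; have := lim_growth_lower w0 adm Tge1 cu; apply: le_trans.
  by rewrite mulr_ge0 ?(ltW (coupling_gt0 w0)) // mass_ge0.
have uc := @unit_cone R.
have bd : forall k, growth (lim_growth (expw a b)) w' k (unit2 R) <=
    \sum_(i < M) growth (lim_growth (expw a b)) w' i (unit2 R).
  apply: periodic_bound => // k; first exact: growth_ge0.
  by rewrite growthD; apply: growth_le.
have adm' : admissible w'.
  apply: (bounded_admissible w'0 (C := (coupling (expw a b))^-1 *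
      \sum_(i < M) growth (lim_growth (expw a b)) w' i (unit2 R))) => k.
  apply: le_trans (ler_wpM2l _ (bd k)); last by rewrite invr_ge0 ltW // coupling_gt0.
  rewrite -growth_scale; last by rewrite invr_ge0 ltW // coupling_gt0.
  apply: growth_le => // u cu; rewrite -ler_pdivrMl ?invrK ?invr_gt0 ?coupling_gt0 //.
  exact: lim_growth_lower.
have := min _ _ adm'; nra.
Qed.
End Minimizer.

(** * Kronecker's theorem *)

Section Kronecker.
Variable R : realType.

Definition frac (x : R) : R := x - (Num.floor x)%:~R.

Lemma frac_itv x : 0 <= frac x < 1.
Proof.
have := floor_itv x; rewrite /frac intrD => /andP[h1 h2].
by apply/andP; split; lra.
Qed.

Lemma truncn_eq_dist (a b : R) : 0 <= a -> 0 <= b -> Num.truncn a = Num.truncn b -> `|a - b| < 1.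
Proof.
move=> a0 b0 E; have := truncn_itv a0; have := truncn_itv b0.
rewrite E -natr1 ltr_norml => /andP[h1 h2] /andP[h3 h4].
by apply/andP; split; lra.
Qed.

Lemma dirichlet n (r : 'I_n -> R) (d : R) : 0 < d ->
  exists q (P : 'I_n -> int), (0 < q)%N /\ forall j, `|q%:R * r j - (P j)%:~R| < d.
Proof.
move=> d0; pose m := Num.truncn d^-1; pose M := m.+1.
have M0 : 0 < M%:R :> R by rewrite ltr0n.
have Md : M%:R^-1 < d by rewrite invf_plt ?posrE // truncnS_gt.
pose f (k : 'I_(M ^ n).+1) : {ffun 'I_n -> 'I_M} :=
  [ffun j => inord (Num.truncn (M%:R * frac (k%:R * r j)))].
have /injectivePn[k1 [k2 k12 E]] : ~~ injectiveb f.
  by apply/negP => /injectiveP/leq_card; rewrite card_ord card_ffun !card_ord ltnn.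
wlog lt12 : k1 k2 k12 E / (k1 < k2)%N.
  move=> W; have [h|h|h] := ltngtP k1 k2; first exact: (W k1 k2).
    by apply: (W k2 k1) => //; rewrite eq_sym.
  by move: k12; rewrite -val_eqE /= h eqxx.
exists (k2 - k1)%N, (fun j => Num.floor (k2%:R * r j) - Num.floor (k1%:R * r j)).
rewrite subn_gt0; split=> // j.
have lt x : (Num.truncn (M%:R * frac x) < M)%N.
  have /andP[h1 h2] := frac_itv x.
  rewrite truncn_lt_nat ?mulr_ge0 ?ler0n //.
  by rewrite gtr_pMr.
have nn x : 0 <= M%:R * frac x by rewrite mulr_ge0 ?ler0n //; case/andP: (frac_itv x).
move/ffunP/(_ j)/(congr1 val): E; rewrite !ffunE /= !inordK // => E.
have := truncn_eq_dist (nn _) (nn _) E.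
rewrite -mulrBr normrM ger0_norm ?ler0n // -ltr_pdivlMl // mulr1 => h.
apply: le_lt_trans (lt_trans h Md).
rewrite distrC natrB ?(ltnW lt12) // intrB /frac.
by rewrite le_eqVlt; apply/orP; left; apply/eqP; congr `|_|; lra.
Qed.

(** Rational independence of the [r j] together with 1. *)
Definition independent n (r : 'I_n -> R) := forall (h : 'I_n -> int) (h0 : int),
  \sum_j (h j)%:~R * r j = h0%:~R -> forall j, h j = 0.

(* Estermann's induction: if q is a simultaneous denominator with small errors e_j, the
   multiples of q move along the line of direction (e_j), whose slopes e_j / e_0 are again
   independent, and whose step is small. *)
Theorem kronecker n (r : 'I_n -> R) : independent r -> forall e, 0 < e ->
  exists K, forall t : 'I_n -> R, exists2 k, (k < K)%N &
    forall j, exists z : int, `|k%:R * r j - t j - z%:~R| < e.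
Proof.
elim: n r => [|n IH] r ind e e0; first by exists 1%N => t; exists 0%N => // -[].
have e2 : 0 < e / 2 by lra.
have [q [P [q0 HP]]] := dirichlet r e2.
pose d j : R := q%:R * r j - (P j)%:~R.
have d0 : d ord0 != 0.
  apply/eqP => d00; pose h (j : 'I_n.+1) : int := if j == ord0 then q%:Z else 0.
  have hs : \sum_j (h j)%:~R * r j = (P ord0)%:~R.
    rewrite big_ord_recl /h eqxx big1 ?addr0 => [|j _]; last by rewrite mul0r.
    by move: d00; rewrite /d /= => /eqP; rewrite subr_eq0 => /eqP.
  have := ind h _ hs ord0; rewrite /h eqxx => -[] /eqP.
  by rewrite gtn_eqF.
pose s : int := (-1) ^+ (d ord0 < 0)%R.
pose sr : R := s%:~R.
have ss : sr * sr = 1 by rewrite /sr /s -intrM -expr2 sqrr_sign.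
have ssz : s * s = 1 by rewrite /s -expr2 sqrr_sign.
have sd : sr * d ord0 = `|d ord0| by rewrite /sr /s rmorph_sign -normrEsign.
have sd0 : 0 < sr * d ord0 by rewrite sd normr_gt0.
pose th j : R := d (lift ord0 j) / d ord0.
have ind' : independent (fun j : 'I_n => sr * th j).
  move=> a a0 E j.
  pose h (i : 'I_n.+1) : int := if unlift ord0 i is Some i' then a i' * s * q%:Z else - (a0 * q%:Z).
  have hs : \sum_i (h i)%:~R * r i =
      (\sum_i a i * s * P (lift ord0 i) - a0 * P ord0)%:~R.
    rewrite big_ord_recl /h unlift_none.
    under eq_bigr => i _ do rewrite liftK.
    have : \sum_i (a i)%:~R * sr * d (lift ord0 i) = a0%:~R * d ord0.
      rewrite -E mulr_suml; apply: eq_bigr => i _.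
      by rewrite /th -!mulrA mulVf // mulr1.
    rewrite /d intrB [RHS]mulrBr => E1.
    have E2 : \sum_i (a i)%:~R * sr * (q%:R * r (lift ord0 i) - (P (lift ord0 i))%:~R) =
       \sum_i (a i * s * q%:Z)%:~R * r (lift ord0 i) - (\sum_i a i * s * P (lift ord0 i))%:~R.
      rewrite rmorph_sum /= -sumrB; apply: eq_bigr => i _.
      by rewrite !intrM mulrBr mulrA.
    move: E1; rewrite E2 intrN !intrM -!pmulrn; lra.
  have /eqP := ind h _ hs (lift ord0 j); rewrite /h liftK !mulf_eq0 => /orP[/orP[/eqP //|/eqP s0]|]; first by move: ssz; rewrite s0.
  by rewrite -[_ == 0]/(q == 0)%N gtn_eqF.
have [K' HK'] := IH _ ind' _ e2.
pose B := (Num.truncn ((K'%:R + 1) / (sr * d ord0))).+1.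
exists (B * q).+1 => t.
(* Here tau, and with it u = s m + tau, is congruent to the first target modulo 1, and u / d_0 >= 0.
   So l = floor(u / d_0) is a natural number, bounded independently of t. *)
pose tau := sr * frac (sr * t ord0).
(* Changing m moves u by integers and keeps the first coordinate fixed modulo 1; the induction
   hypothesis selects m so that the remaining coordinates u * th fit. *)
have [m mK Hm] := HK' (fun j => t (lift ord0 j) - tau * th j).
pose u := sr * m%:R + tau.
have su : sr * u = m%:R + frac (sr * t ord0).
  by rewrite mulrDr /tau !mulrA ss !mul1r.
have /andP[f0 f1] := frac_itv (sr * t ord0).
have su0 : 0 <= sr * u by rewrite su addr_ge0 ?ler0n.
have ud : u / d ord0 = sr * u / (sr * d ord0).
  have sr0 : sr != 0 by apply/eqP => h; move: ss; rewrite h mul0r => /eqP; rewrite eq_sym oner_eq0.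
  by rewrite invfM mulrACA mulfV // mul1r.
have ud0 : 0 <= u / d ord0 by rewrite ud divr_ge0 // ltW.
pose l := Num.truncn (u / d ord0).
have /andP[l1 l2] := truncn_itv ud0.
have lb : `|l%:R - u / d ord0| <= 1.
  by move: l1 l2; rewrite -/l -natr1 ler_norml => l1 l2; apply/andP; split; lra.
exists (l * q)%N.
  rewrite ltnS leq_pmul2r //; apply: leq_trans (leqnSn _); apply: le_truncn.
  rewrite ud ler_pM2r ?invr_gt0 // su; have : m%:R <= K'%:R :> R by rewrite ler_nat ltnW.
  lra.
have dj j : `|l%:R * d j - u / d ord0 * d j| < e / 2.
  rewrite -mulrBl normrM; apply: le_lt_trans (HP j).
  by rewrite ler_piMl.
have kd j : (l * q)%:R * r j = l%:R * d j + (l%:Z * P j)%:~R.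
  by rewrite natrM intrM -pmulrn /d mulrBr mulrA subrK.
move=> j; case: (unliftP ord0 j) => [i ->|->]; last first.
  exists (l%:Z * P ord0 + s * m%:Z - s * Num.floor (sr * t ord0)).
  have := dj ord0; rewrite divfK // kd => h.
  have tE : tau = t ord0 - sr * (Num.floor (sr * t ord0))%:~R.
    by rewrite /tau /frac mulrBr mulrA ss mul1r.
  have -> : l%:R * d ord0 + (l%:Z * P ord0)%:~R - t ord0 -
      (l%:Z * P ord0 + s * m%:Z - s * Num.floor (sr * t ord0))%:~R = l%:R * d ord0 - u.
    by rewrite /u tE intrB intrD (intrM _ s m) (intrM _ s (Num.floor _)) -pmulrn /sr; lra.
  by apply: lt_trans h _; lra.
have [z Hz] := Hm i.
exists (l%:Z * P (lift ord0 i) + z); rewrite kd.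
have := dj (lift ord0 i).
have -> : u / d ord0 * d (lift ord0 i) = u * th i by rewrite /th mulrAC mulrA.
rewrite intrD => h.
have -> : l%:R * d (lift ord0 i) + (l%:Z * P (lift ord0 i))%:~R - t (lift ord0 i) -
    ((l%:Z * P (lift ord0 i))%:~R + z%:~R) =
  (l%:R * d (lift ord0 i) - u * th i) + (m%:R * (sr * th i) - (t (lift ord0 i) - tau * th i) - z%:~R).
  by rewrite /u; lra.
by apply: le_lt_trans (ler_normD _ _) _; lra.
Qed.
End Kronecker.

(** * Rationally independent slopes from logarithms of primes *)

Section LogPrimes.
Variable R : realType.

Lemma ln_prod_prime n (c : 'I_n -> nat) (a : 'I_n -> nat) : (forall j, 0 < c j)%N ->
  \sum_j (a j)%:R * ln ((c j)%:R : R) = ln (\prod_j (c j ^ a j))%:R.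
Proof.
move=> c0; suff [] : (\sum_j (a j)%:R * ln ((c j)%:R : R) = ln (\prod_j (c j ^ a j))%:R)
    /\ (0 < \prod_j (c j ^ a j))%N by [].
apply: (big_rec2 (fun (s : R) m => s = ln m%:R /\ (0 < m)%N)); first by rewrite ln1.
move=> j s m _ [-> m0]; split; last by rewrite muln_gt0 expn_gt0 c0.
rewrite natrM lnM ?posrE ?ltr0n ?expn_gt0 ?c0 // natrX lnXn ?ltr0n //.
by rewrite mulr_natl.
Qed.

Lemma logn_prod_prime n (c : 'I_n -> nat) (a : 'I_n -> nat) i :
  injective c -> (forall j, prime (c j)) -> logn (c i) (\prod_j (c j ^ a j)) = a i.
Proof.
move=> cI cp.
have -> : logn (c i) (\prod_j (c j ^ a j)) = (\sum_j a j * (i == j))%N.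
  suff [] : (logn (c i) (\prod_j (c j ^ a j)) = (\sum_j a j * (i == j))%N)
      /\ (0 < \prod_j (c j ^ a j))%N by [].
  apply: (big_rec2 (fun m s => logn (c i) m = s /\ (0 < m)%N)); first by rewrite logn1.
  move=> j m s _ [E m0]; have c0 := prime_gt0 (cp j).
  split; last by rewrite muln_gt0 expn_gt0 c0.
  by rewrite lognM ?expn_gt0 ?c0 // lognX logn_prime // E (inj_eq cI).
rewrite (bigD1 i) //= eqxx muln1 big1 ?addn0 // => j /negPf.
by rewrite eq_sym => ->; rewrite muln0.
Qed.

(** Positive and negative coefficients are separated, so that exponentiating gives two equal
    products of prime powers; the exponents are then compared by unique factorisation. *)
Lemma ln_primes_free n (c : 'I_n -> nat) (h : 'I_n -> int) :
  injective c -> (forall j, prime (c j)) ->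
  \sum_j (h j)%:~R * ln ((c j)%:R : R) = 0 -> forall j, h j = 0.
Proof.
move=> cI cp E i.
have c0 j : (0 < c j)%N by exact: prime_gt0.
pose a j := if 0 <= h j then `|h j|%N else 0%N.
pose b j := if 0 <= h j then 0%N else `|h j|%N.
have hab j : (h j)%:~R = (a j)%:R - (b j)%:R :> R.
  rewrite /a /b; case: ifP => h0; first by rewrite subr0 natr_absz ger0_norm.
  by rewrite sub0r natr_absz ltr0_norm ?ltNge ?h0 // intrN opprK.
have /(congr1 (logn (c i))) : (\prod_j (c j ^ a j) = \prod_j (c j ^ b j))%N.
  apply/eqP; rewrite -(eqr_nat R); apply/eqP.
  have p0 (f : 'I_n -> nat) : (0 < \prod_j (c j ^ f j))%N.
    by rewrite prodn_gt0 // => j; rewrite expn_gt0 c0.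
  apply: ln_inj; rewrite ?posrE ?ltr0n ?p0 // -!ln_prod_prime //.
  apply/eqP; rewrite -subr_eq0 -sumrB; apply/eqP; rewrite -[RHS]E.
  by apply: eq_bigr => j _; rewrite hab mulrBl.
rewrite !logn_prod_prime // /a /b; case: ifP => _; last by move/esym/eqP; rewrite absz_eq0 => /eqP.
by move/eqP; rewrite absz_eq0 => /eqP.
Qed.

Fixpoint prime_seq n : nat := if n is n'.+1 then s2val (prime_above (prime_seq n')) else 2.

Lemma prime_seqP n : prime (prime_seq n).
Proof. by case: n => //= n; by case: prime_above. Qed.

Lemma prime_seq_lt m n : (m < n)%N -> (prime_seq m < prime_seq n)%N.
Proof.
elim: n => // n IH; rewrite ltnS leq_eqVlt => mn.
have h : (prime_seq n < prime_seq n.+1)%N by rewrite /=; case: prime_above.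
by case/predU1P: mn => [->//|/IH]/ltn_trans; apply.
Qed.

(** Dividing by the logarithm of a further, larger prime brings the slopes into (0, 1) and turns the
    integer [h0] into the coefficient of that prime. *)
Lemma exists_independent n : exists r : 'I_n -> R,
  (forall j, 0 < r j < 1) /\ independent r.
Proof.
pose L k := ln ((prime_seq k)%:R : R).
have L0 k : 0 < L k by apply: ln_gt0; rewrite ltr1n prime_gt1 // prime_seqP.
exists (fun j => L j / L n); split=> [j|h h0].
  rewrite divr_gt0 //= ltr_pdivrMr // mul1r /L ltr_ln ?posrE ?ltr0n ?prime_gt0 ?prime_seqP //.
  by rewrite ltr_nat; exact: prime_seq_lt.
move=> E j.
pose g (i : 'I_n.+1) : int := if unlift ord_max i is Some i' then h i' else - h0.
have : \sum_i (g i)%:~R * ln ((prime_seq i)%:R : R) = 0.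
  rewrite (bigD1_ord ord_max) // /g unlift_none.
  under eq_bigr => i _ do rewrite liftK lift_max -/(L i).
  rewrite /= -/(L n) intrN -E mulNr mulr_suml addrC; apply/eqP; rewrite subr_eq0; apply/eqP.
  by apply: eq_bigr => i _; rewrite -mulrA divfK // lt0r_neq0.
move/ln_primes_free => /(_ _ _ (lift ord_max j)); rewrite /g liftK; apply.
  move=> i k /=; have [ik|ik|ik] := ltngtP i k; last by move=> _; exact: val_inj.
    by have := prime_seq_lt ik => + e; rewrite e ltnn.
  by have := prime_seq_lt ik => + e; rewrite e ltnn.
by move=> i; exact: prime_seqP.
Qed.
End LogPrimes.

(** * Factors of optimal words *)

Section Factors.
Variable R : realType.
Implicit Types (r th : R) (x : nat -> bool).

Definition cut r (i : nat) : R := frac (- (i%:R * r)).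

Lemma cutE r i : i%:R * r = - cut r i - (Num.floor (- (i%:R * r)))%:~R.
Proof. by rewrite /cut /frac; lra. Qed.

Lemma cut0 r : cut r 0 = 0.
Proof. by rewrite /cut /frac mul0r oppr0 floor0 subr0. Qed.

Lemma int_lt1_eq0 (m : int) : -1 < (m%:~R : R) < 1 -> m = 0.
Proof. by rewrite -[-1 : R](intrN _ 1) -[1 : R]/(1%:~R) !ltr_int; lia. Qed.

(** The discrepancy bounds confine each prefix count to an interval of length 1, whose endpoints are
    not integers when the phase k r + th lies strictly inside a cell modulo 1. So every count is
    forced, and it is smaller by one exactly for the cuts above the cell. *)
Lemma window_ones r th x N k n i (z : int) e :
  (forall m, (m <= N)%N -> th - 1 <= (ones x m)%:R - m%:R * r <= th) ->
  (k + n <= N)%N -> cut r i < k%:R * r + th - z%:~R < cut r i + e ->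
  (forall i', (i' <= n)%N -> cut r i < cut r i' -> cut r i + e <= cut r i') ->
  cut r i + e <= 1 ->
  forall i', (i' <= n)%N -> (ones (shift k x) i')%:R =
    - (Num.floor (- (i'%:R * r)))%:~R - (cut r i < cut r i')%R%:R :> R.
Proof.
move=> Hth kn /andP[y1 y2] gap e1.
have key i' : (i' <= n)%N -> (ones x (k + i'))%:R =
    z%:~R - (Num.floor (- (i'%:R * r)))%:~R - (cut r i < cut r i')%R%:R :> R.
  move=> i'n; have := Hth (k + i')%N (leq_trans _ kn); rewrite leq_add2l => /(_ i'n).
  rewrite natrD mulrDl => /andP[h1 h2].
  have /andP[c0 c1] := frac_itv (- (i'%:R * r)); rewrite -/(cut r i') in c0 c1.
  have /andP[d0 d1] := frac_itv (- (i%:R * r)); rewrite -/(cut r i) in d0 d1.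
  pose m : int := (ones x (k + i'))%:Z - z + Num.floor (- (i'%:R * r)) +
    Posz (nat_of_bool (cut r i < cut r i')%R).
  have mE : m%:~R = (ones x (k + i'))%:R - z%:~R + (Num.floor (- (i'%:R * r)))%:~R +
      (cut r i < cut r i')%R%:R :> R by rewrite /m !intrD intrN -!pmulrn.
  suff m0 : m = 0 by move: mE; rewrite m0; lra.
  apply: int_lt1_eq0; rewrite mE.
  have E := cutE r i'; case: (ltP (cut r i)) => g /=; last by apply/andP; split; lra.
  by have gi := gap _ i'n g; apply/andP; split; lra.
have A0 := key 0%N (leq0n _).
move=> i' i'n; have := key i' i'n.
rewrite onesD natrD -[in ones x k](addn0 k) A0 cut0 mul0r oppr0 floor0 ltNge.
by case/andP: (frac_itv (- (i%:R * r))) => -> _ /=; lra.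
Qed.

(** An intercept for a finite word: windows have discrepancy at most 1, so any two prefix
    discrepancies differ by at most 1, and their maximum can be taken as [th]. *)
Lemma exists_phase r x N :
  (forall a m, (a + m <= N)%N -> `|(ones (shift a x) m)%:R - m%:R * r| <= 1) ->
  exists th, forall m, (m <= N)%N -> th - 1 <= (ones x m)%:R - m%:R * r <= th.
Proof.
move=> H; pose e m : R := (ones x m)%:R - m%:R * r.
exists (\big[Num.max/e 0%N]_(i < N.+1) e i) => m mN; rewrite -/(e m); apply/andP; split; last first.
  exact: (le_bigmax _ (fun i : 'I_N.+1 => e i) (Ordinal (mN : (m < N.+1)%N))).
rewrite lerBlDr.
have D a : (a <= N)%N -> e a <= e m + 1.
  move=> aN; have [am|/ltnW ma] := leqP a m.
    have := H a (m - a)%N; rewrite subnKC // => /(_ mN).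
    have E : (ones x m)%:R = (ones x a)%:R + (ones (shift a x) (m - a))%:R :> R.
      by rewrite -natrD -onesD subnKC.
    have F : m%:R = a%:R + (m - a)%:R :> R by rewrite -natrD subnKC.
    by rewrite /e E F mulrDl ler_norml => /andP[]; lra.
  have := H m (a - m)%N; rewrite subnKC // => /(_ aN).
  have E : (ones x a)%:R = (ones x m)%:R + (ones (shift m x) (a - m))%:R :> R.
    by rewrite -natrD -onesD subnKC.
  have F : a%:R = m%:R + (a - m)%:R :> R by rewrite -natrD subnKC.
  by rewrite /e E F mulrDl ler_norml => /andP[]; lra.
by apply: bigmax_le => [|i _]; apply: D; rewrite // -ltnS.
Qed.

Lemma exists_lower_bound (T : finType) (f : T -> R) : (forall t, 0 < f t) ->
  exists2 e, 0 < e & forall t, e <= f t.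
Proof.
move=> f0; exists (\big[Num.min/1]_t f t); first by apply/bigmin_gtP; split=> // t _.
by move=> t; exact: bigmin_le.
Qed.

Lemma independent_cut_inj n (r : 'I_n -> R) j : independent r -> injective (cut (r j)).
Proof.
move=> ind i i' E; apply/eqP; rewrite -eqz_nat.
pose h (l : 'I_n) : int := if l == j then i%:Z - i'%:Z else 0.
have hs : \sum_l (h l)%:~R * r l =
    (Num.floor (- (i'%:R * r j)) - Num.floor (- (i%:R * r j)))%:~R.
  rewrite (bigD1 j) //= /h eqxx big1 => [|l /negPf ->]; last by rewrite mul0r.
  by rewrite addr0 !intrB mulrBl -!pmulrn; move: E; rewrite /cut /frac; lra.
by have := ind h _ hs j; rewrite /h eqxx => /eqP; rewrite subr_eq0.
Qed.

(* Windows of length n of a balanced word with irrational slope are determined by the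
   cell of the circle, cut at the points -ir, that contains the phase; by Kronecker all
   combinations of cells occur simultaneously. *)
Lemma factor_separation p (r : 'I_p -> R) n : independent r -> exists K,
  forall x : 'I_p -> nat -> bool,
    (forall j a m, (a + m <= K)%N -> `|(ones (shift a (x j)) m)%:R - m%:R * r j| <= 1) ->
  exists k : {ffun 'I_p -> 'I_n.+1} -> nat, (forall f, k f + n <= K)%N /\
    forall f g, (forall j i, (i < n)%N -> x j (k f + i)%N = x j (k g + i)%N) -> f = g.
Proof.
move=> ind.
pose gap (t : 'I_p * 'I_n.+1 * 'I_n.+1) : R := let: (j, i, i') := t in
  if cut (r j) i < cut (r j) i' then cut (r j) i' - cut (r j) i else 1 - cut (r j) i.
have [|e e0 He] := @exists_lower_bound _ gap.
  move=> [[j i] i']; rewrite /gap; case: ifP => h; rewrite subr_gt0 //.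
  by case/andP: (frac_itv (- (i%:R * r j))).
have e2 : 0 < e / 2 by lra.
have [K HK] := kronecker ind e2.
exists (K + n)%N => x Hx.
have /choice[th Hth] : forall j, exists th, forall m, (m <= K + n)%N ->
    th - 1 <= (ones (x j) m)%:R - m%:R * r j <= th.
  by move=> j; apply: exists_phase; exact: Hx.
(* The target is the midpoint of the cell of width e that follows the cut numbered [f j], with
   tolerance e / 2, for all j at once. *)
have /choice[k Hk] : forall f : {ffun 'I_p -> 'I_n.+1}, exists k, (k < K)%N /\
    forall j, exists z : int, `|k%:R * r j - (cut (r j) (f j) + e / 2 - th j) - z%:~R| < e / 2.
  by move=> f; have [k kK H] := HK (fun j => cut (r j) (f j) + e / 2 - th j); exists k.
exists k; split=> [f|f g E]; first by rewrite leq_add2r ltnW //; case: (Hk f).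
have W f' j i' : (i' <= n)%N -> (ones (shift (k f') (x j)) i')%:R =
    - (Num.floor (- (i'%:R * r j)))%:~R - (cut (r j) (f' j) < cut (r j) i')%R%:R :> R.
  have [kK /(_ j)[z]] := Hk f'; rewrite ltr_norml => /andP[z1 z2].
  apply: (window_ones (z := z) (e := e) (Hth j)).
  - by rewrite leq_add2r ltnW.
  - by apply/andP; split; lra.
  - move=> l ln lt; have := He (j, f' j, Ordinal (ln : (l < n.+1)%N)).
    by rewrite /gap /= lt; lra.
  - have := He (j, f' j, f' j); rewrite /gap /= ltxx; lra.
apply/ffunP => j; apply: val_inj; apply: (independent_cut_inj (j := j) ind).
have S i' : (i' <= n)%N -> (cut (r j) (f j) < cut (r j) i') = (cut (r j) (g j) < cut (r j) i').
  move=> i'n; have : (ones (shift (k f) (x j)) i')%:R = (ones (shift (k g) (x j)) i')%:R :> R.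
    congr _%:R; apply: eq_bigr => l _; rewrite /shift E //.
    exact: leq_trans (ltn_ord l) i'n.
  rewrite !W // => h.
  have {}h : (cut (r j) (f j) < cut (r j) i')%R%:R = (cut (r j) (g j) < cut (r j) i')%R%:R :> R by lra.
  by move/eqP: h; rewrite eqr_nat; do 2 case: (cut _ _ < _).
have Fn : (f j <= n)%N by rewrite -ltnS.
have Gn : (g j <= n)%N by rewrite -ltnS.
by apply/eqP; rewrite eq_le !leNgt -(S _ Fn) (S _ Gn) !ltxx.
Qed.

(** All windows of z are optimal, hence pairwise comparable under [ahead]. The sum [A] of the n
    prefix counts separates different windows of this chain, and it varies by at most n because each
    count varies by at most 1. This leaves n + 1 ranks, the Sturmian number of factors. *)
Lemma factor_rank (w : bool -> R) v z n : positive_weights w -> admissible w ->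
  (forall n, 1 <= max_growth w n (unit2 R)) -> (forall n, ext w v z n) ->
  exists rho : nat -> 'I_n.+1, forall k k', rho k = rho k' ->
    forall i, (i < n)%N -> z (k + i)%N = z (k' + i)%N.
Proof.
move=> w0 adm Tge1 ez.
pose A k := \sum_(i < n) ones (shift k z) i.+1.
have ch k k' : ahead (shift k z) (shift k' z) n \/ ahead (shift k' z) (shift k z) n.
  have h l : ext w (orbit z v l) (shift l z) n by case: (ext_split w0 adm Tge1 (ez (l + n)%N)).
  exact: ext_chain (h k) (h k').
have A_ahead k k' : ahead (shift k z) (shift k' z) n -> (A k <= A k' <= A k + n)%N.
  move=> a; apply/andP; split; first by apply: leq_sum => i _; case/andP: (a _ (ltn_ord i)).
  have -> : (A k + n = \sum_(i < n) (ones (shift k z) i.+1).+1)%N.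
    under eq_bigr => i _ do rewrite -addn1.
    by rewrite big_split /= sum1_card card_ord.
  by apply: leq_sum => i _; case/andP: (a _ (ltn_ord i)).
have exA : exists m, `[< exists k, A k = m >] by exists (A 0%N); apply/asboolP; exists 0%N.
case: (ex_minnP exA) => m /asboolP[k0 k0m] mmin.
have Am k : (m <= A k)%N by apply: mmin; apply/asboolP; exists k.
have An k : (A k - m < n.+1)%N.
  by rewrite ltnS leq_subLR -k0m; case: (ch k k0) => /A_ahead; lia.
exists (fun k => Ordinal (An k)) => k k' /(congr1 val) /= E.
have {}E : A k = A k' by have := Am k; have := Am k'; lia.
suff H i : (i <= n)%N -> ones (shift k z) i = ones (shift k' z) i.
  move=> i i_n; have := H i.+1 i_n; rewrite !onesS H 1?ltnW // => /addnI.
  by rewrite /shift; case: (z _); case: (z _).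
wlog a : k k' E / ahead (shift k z) (shift k' z) n.
  by move=> W i_n; case: (ch k k') => a; [|symmetry]; apply: W.
case: i => [|i] i_n; first by rewrite !ones0.
have le l : true -> (ones (shift k z) (l : 'I_n).+1 <= ones (shift k' z) l.+1)%N.
  by move=> _; case/andP: (a _ (ltn_ord l)).
have := leqif_sum (fun l _ => leqif_eq (le l isT)) (P := xpredT).
rewrite -/(A k) -/(A k') => -[_]; rewrite E eqxx => /esym/forallP/(_ (Ordinal i_n)) /=.
by move/eqP.
Qed.
End Factors.

(** * Matrices *)

Section OperatorNorm.
Variable d : nat.
Local Notation R := Rdefinitions.R.
Implicit Types (u v : 'cV[R]_d) (A : 'M[R]_d).

Lemma vnorm_le_sum u : vnorm u <= \sum_i `|u i ord0|.
Proof.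
have s0 : 0 <= \sum_i `|u i ord0| by apply: sumr_ge0.
rewrite /vnorm -[leRHS]ger0_norm // -sqrtr_sqr ler_sqrt ?sqr_ge0 //.
rewrite expr2 mulr_suml; apply: ler_sum => i _.
rewrite -normr_id -[X in X <= _]real_normK ?num_real // normr_id expr2 ler_wpM2l //.
by rewrite (bigD1 i) //= lerDl sumr_ge0.
Qed.

Lemma entry_le_vnorm u i : `|u i ord0| <= vnorm u.
Proof.
rewrite -sqrtr_sqr /vnorm ler_sqrt; last by apply: sumr_ge0 => k _; exact: sqr_ge0.
by rewrite (bigD1 i) //= lerDl sumr_ge0 // => k _; exact: sqr_ge0.
Qed.

Lemma vnorm_mul_le A v : vnorm v <= 1 -> vnorm (A *m v) <= \sum_i \sum_k `|A i k|.
Proof.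
move=> v1; apply: le_trans (vnorm_le_sum _) _; apply: ler_sum => i _.
rewrite mxE; apply: le_trans (ler_norm_sum _ _ _) _; apply: ler_sum => k _.
by rewrite normrM ler_piMr // (le_trans (entry_le_vnorm _ _)).
Qed.

Lemma opnorm_le_sum A : opnorm A <= \sum_i \sum_k `|A i k|.
Proof.
apply: ge_sup.
  exists (vnorm (A *m 0)), 0 => //=.
  by apply: le_trans (vnorm_le_sum _) _; rewrite big1 // => i _; rewrite mxE normr0.
by move=> _ [v v1 <-]; exact: vnorm_mul_le.
Qed.

Lemma entry_le_opnorm A i k : `|A i k| <= opnorm A.
Proof.
pose v : 'cV[R]_d := \col_l (l == k)%:R.
have Av : (A *m v) i ord0 = A i k.
  rewrite mxE (bigD1 k) //= mxE eqxx mulr1 big1 ?addr0 // => l lk.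
  by rewrite mxE (negPf lk) mulr0.
rewrite -Av; apply: le_trans (entry_le_vnorm _ _) _.
apply: ub_le_sup; first by exists (\sum_i \sum_k `|A i k|) => _ [u u1 <-]; exact: vnorm_mul_le.
exists v => //=; apply: le_trans (vnorm_le_sum _) _.
rewrite (bigD1 k) //= mxE eqxx normr1 big1 ?addr0 // => l lk.
by rewrite mxE (negPf lk) normr0.
Qed.

(** Together with [opnorm_le_sum], this lets the sum of entries replace the operator norm of a
    nonnegative matrix up to a constant factor, to which both notions of extremality are
    insensitive. *)
Lemma sum_le_opnorm A : \sum_i \sum_k A i k <= (d * d)%:R * opnorm A.
Proof.
have E : (d * d)%:R * opnorm A = \sum_(i < d) \sum_(k < d) opnorm A.
  under eq_bigr do rewrite sumr_const card_ord.
  by rewrite sumr_const card_ord -mulrnA mulr_natl.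
rewrite E; apply: ler_sum => i _; apply: ler_sum => k _.
exact: le_trans (ler_norm _) (entry_le_opnorm _ _ _).
Qed.
End OperatorNorm.

(** * Matrices over a finite index type, padded with zeros *)

Section Embedding.
Variables (R : comNzRingType) (X : finType) (D : nat) (enc : X -> 'I_D).
Hypothesis encI : injective enc.
Implicit Types (f g : X -> X -> R).

Definition embed f : 'M[R]_D :=
  \matrix_(i, k) \sum_(x | enc x == i) \sum_(y | enc y == k) f x y.

Lemma sum_fibers (F : 'I_D -> X -> R) :
  \sum_i \sum_(x | enc x == i) F i x = \sum_x F (enc x) x.
Proof.
rewrite (exchange_big_dep xpredT) //=; apply: eq_bigr => x _.
by rewrite (big_pred1 (enc x)) // => i; rewrite /= eq_sym.
Qed.

Lemma sum_embed f : \sum_i \sum_k embed f i k = \sum_x \sum_y f x y.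
Proof.
transitivity (\sum_i \sum_(x | enc x == i) \sum_k \sum_(y | enc y == k) f x y).
  apply: eq_bigr => i _; rewrite exchange_big /=; apply: eq_bigr => k _.
  by rewrite mxE.
rewrite sum_fibers; apply: eq_bigr => x _; exact: sum_fibers.
Qed.

Definition conv f g x y : R := \sum_z f x z * g z y.

Lemma embed_mul f g : embed f *m embed g = embed (conv f g).
Proof.
apply/matrixP => i k; rewrite !mxE.
transitivity (\sum_(x | enc x == i) \sum_(y | enc y == k)
    \sum_l \sum_(z | enc z == l) f x z * (\sum_(z' | enc z' == l) g z' y)).
  under eq_bigr => l _.
    rewrite !mxE mulr_suml; under eq_bigr => x _ do rewrite exchange_big /= mulr_sumr.
    over.
  rewrite exchange_big /=; apply: eq_bigr => x _; rewrite exchange_big /=.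
  by apply: eq_bigr => y _; apply: eq_bigr => l _; rewrite mulr_suml.
apply: eq_bigr => x _; apply: eq_bigr => y _.
rewrite sum_fibers; apply: eq_bigr => z _; congr (_ * _).
by rewrite (big_pred1 z) // => z'; rewrite /= (inj_eq encI).
Qed.
End Embedding.

(** * Tensor products of 2 x 2 matrices with a cyclic clock *)

Section CyclicTensor.
Variables (R : comNzRingType) (p L : nat).
Hypothesis L0 : (0 < L)%N.
Variables (G : nat -> bool -> 'I_p -> 'M[R]_2) (chk : nat -> bool -> R).
Local Notation X := ('I_L * {ffun 'I_p -> 'I_2})%type.

Fixpoint factor (x : nat -> bool) (s n : nat) (j : 'I_p) : 'M[R]_2 :=
  if n is n'.+1 then G ((s + n') %% L)%N (x n') j *m factor x s n' j else 1%:M.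

Definition validity (x : nat -> bool) (s n : nat) : R := \prod_(t < n) chk ((s + t) %% L)%N (x t).

Definition one_step (b : bool) (u v : X) : R :=
  ((u.1 : nat) == ((v.1 + 1) %% L)%N)%:R * chk v.1 b * \prod_j G v.1 b j (u.2 j) (v.2 j).

Definition n_step (x : nat -> bool) (n : nat) (u v : X) : R :=
  ((u.1 : nat) == ((v.1 + n) %% L)%N)%:R * validity x v.1 n *
    \prod_j factor x v.1 n j (u.2 j) (v.2 j).

(** The clock leaves a single intermediate time, and distributing a product over sums yields the
    mixed-product rule for tensor products. *)
Lemma n_stepS x n (u v : X) :
  conv (one_step (x n)) (n_step x n) u v = n_step x n.+1 u v.
Proof.
case: u v => s a [t b]; rewrite /conv.
rewrite -(pair_bigA _ (fun z1 z2 => one_step (x n) (s, a) (z1, z2) * n_step x n (z1, z2) (t, b))) /=.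
pose m : 'I_L := Ordinal (ltn_pmod (t + n) L0).
rewrite (bigD1 m) //= [X in _ + X]big1 ?addr0; last first.
  move=> z zm; apply: big1 => c _; rewrite /n_step /=.
  by move: zm; rewrite -val_eqE /= => /negPf ->; rewrite !mul0r mulr0.
rewrite /one_step /n_step /= eqxx mul1r modnDml -addnA addn1.
under eq_bigr => c _ do rewrite mulrACA -big_split /=.
rewrite -mulr_sumr -(bigA_distr_bigA (fun j c => G m (x n) j (a j) c * factor x t n j c (b j))) /=.
rewrite /validity big_ord_recr /= -!mulrA; congr (_ * _).
rewrite mulrCA; congr (_ * (_ * _)); apply: eq_bigr => j _; rewrite mxE.
by apply: eq_bigr => c _.
Qed.

Definition total (M : 'M[R]_2) : R := \sum_i \sum_k M i k.

Lemma sum_n_step x n : \sum_u \sum_v n_step x n u v =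
  \sum_(s < L) validity x s n * \prod_j total (factor x s n j).
Proof.
rewrite exchange_big /= -(pair_bigA _ (fun s b => \sum_u n_step x n u (s, b))) /=.
apply: eq_bigr => s _.
have -> : \prod_j total (factor x s n j) =
    \sum_(b : {ffun 'I_p -> 'I_2}) \sum_(a : {ffun 'I_p -> 'I_2}) \prod_j factor x s n j (a j) (b j).
  rewrite exchange_big /= /total.
  rewrite (bigA_distr_bigA (fun j i => \sum_k factor x s n j i k)) /=; apply: eq_bigr => a _.
  by rewrite (bigA_distr_bigA (fun j k => factor x s n j (a j) k)).
rewrite mulr_sumr; apply: eq_bigr => b _.
rewrite -(pair_bigA _ (fun z a => n_step x n (z, a) (s, b))) /=.
pose m : 'I_L := Ordinal (ltn_pmod (s + n) L0).
rewrite (bigD1 m) //= [X in _ + X]big1 ?addr0; last first.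
  move=> z zm; apply: big1 => c _; rewrite /n_step /=.
  by move: zm; rewrite -val_eqE /= => /negPf ->; rewrite !mul0r.
by rewrite mulr_sumr; apply: eq_bigr => a _; rewrite /n_step /= eqxx mul1r.
Qed.
End CyclicTensor.

(** * Exponential growth rates and the joint spectral radius *)

Section GrowthRates.
Local Notation R := Rdefinitions.R.
Local Open Scope classical_set_scope.

Lemma cvg_root (c : R) : 0 < c -> (fun n : nat => c `^ (n%:R)^-1) @ \oo --> (1 : R).
Proof.
move=> c0.
have -> : (fun n : nat => c `^ (n%:R)^-1) = (fun n : nat => expR (n%:R^-1 * ln c)).
  by apply/funext => n; rewrite /powR gt_eqF.
have h0 : (fun n : nat => (n%:R : R)^-1) @ \oo --> (0 : R).
  by rewrite -cvg_shiftS; exact: cvg_harmonic.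
have h : (fun n : nat => expR (n%:R^-1 * ln c)) @ \oo --> expR (0 * ln c).
  apply: continuous_cvg; first exact: continuous_expR.
  by apply: cvgM => //; exact: cvg_cst.
by move: h; rewrite mul0r exp.expR0.
Qed.

Lemma limn_esup_root_lt1 (a : nat -> R) (C q : R) (l M : nat) :
  (forall n, 0 <= a n) -> 0 < q -> q < 1 -> (0 < M)%N ->
  (forall n, (0 < n)%N -> a n <= C * q ^+ ((n - l) %/ M)) ->
  (limn_esup (fun n => (a n `^ (n%:R)^-1)%:E) < 1)%E.
Proof.
move=> a0 q0 q1 M0 H.
have C0 : 0 <= C by have := le_trans (a0 1%N) (H 1%N isT); rewrite pmulr_lge0 // exprn_gt0.
have Mr : 0 < M%:R :> R by rewrite ltr0n.
(* By Bernoulli, s = 1 - d satisfies s^M >= (1 + q) / 2 > q, so s is a rate below 1 that still beats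
   q per block. *)
pose d := (1 - q) / (2 * M%:R).
have d0 : 0 < d by rewrite divr_gt0 ?mulr_gt0 //; lra.
have d1 : d <= 2^-1.
  rewrite ler_pdivrMr ?mulr_gt0 // mulrA mulVf // mul1r.
  have : 1 <= M%:R :> R by rewrite ler1n.
  lra.
pose s := 1 - d.
have s0 : 0 < s by rewrite /s; lra.
have s1 : s < 1 by rewrite /s; lra.
have bern k : 1 - d *+ k <= s ^+ k.
  elim: k => [|k IH]; first by rewrite mulr0n subr0.
  have : 0 <= d *+ k by rewrite mulrn_wge0 // ltW.
  rewrite exprS mulrS; move: IH d0 d1; rewrite /s; set u := _ ^+ k; set v := _ *+ k; nra.
have sM : q < s ^+ M.
  apply: lt_le_trans (bern M); rewrite -mulr_natr /d.
  by rewrite invfM mulrA divfK ?lt0r_neq0 //; lra.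
have sM0 : 0 < s ^+ M by rewrite exprn_gt0.
pose t := q / s ^+ M.
have t0 : 0 <= t by rewrite divr_ge0 // ltW.
have t1 : t < 1 by rewrite ltr_pdivrMr // mul1r.
have C1 : 0 < s ^+ (l + M) / (C + 1) by rewrite divr_gt0 ?exprn_gt0 //; lra.
(* After j blocks the gain (q / s^M)^j absorbs both the constant C and the l + M letters lost to the
   offset and to rounding. *)
have [j Hj] := expr_small t0 t1 C1.
have key n : (l + j * M <= n)%N -> (0 < n)%N -> a n <= s ^+ n.
  move=> jn n0; apply: le_trans (H n n0) _.
  set k := ((n - l) %/ M)%N.
  have jk : (j <= k)%N by rewrite leq_divRL // leq_subRL // (leq_trans _ jn) ?leq_addr.
  have nk : (n <= l + M + k * M)%N.
    by rewrite -addnA -leq_subLR -mulSn ltnW // ltn_ceil.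
  have h1 : s ^+ (l + M) * (s ^+ M) ^+ k <= s ^+ n.
    rewrite -exprM -exprD; apply: ler_wiXn2l => //; [exact: ltW | exact: ltW | ].
    by rewrite (mulnC M k).
  apply: le_trans h1.
  have -> : q ^+ k = t ^+ k * (s ^+ M) ^+ k by rewrite -exprMn /t divfK // lt0r_neq0.
  rewrite mulrA; apply: ler_wpM2r; first by rewrite exprn_ge0 // ltW.
  have tk : t ^+ k <= t ^+ j by apply: ler_wiXn2l => //; exact: ltW.
  have Cp : 0 < C + 1 by lra.
  have tj : 0 <= t ^+ j by rewrite exprn_ge0.
  have Cj : C * t ^+ k <= C * t ^+ j by apply: ler_wpM2l.
  by apply: (le_trans Cj); move: Hj; rewrite ltr_pdivlMr // mulrDr mulr1 mulrC; lra.
suff : (limn_esup (fun n => (a n `^ (n%:R)^-1)%:E) <= s%:E)%E.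
  by move=> h; apply: (le_lt_trans h); rewrite lte_fin.
apply: ereal_inf_le.
pose V := [set n : nat | (l + j * M < n)%N].
exists (ereal_sup [set (a n `^ (n%:R)^-1)%:E | n in V]).
  by exists V => //; exists (l + j * M).+1.
apply: ge_ereal_sup => _ [n /= Vn <-]; rewrite lee_fin.
have n0 : (0 < n)%N by apply: leq_ltn_trans Vn.
have -> : s = (s ^+ n) `^ (n%:R)^-1.
  rewrite -powR_mulrn ?(ltW s0) // -powRrM mulfV ?powRr1 ?(ltW s0) //.
  by rewrite pnatr_eq0 -lt0n.
apply: ge0_ler_powR; rewrite ?nnegrE ?invr_ge0 ?ler0n ?exprn_ge0 ?(ltW s0) //.
exact: key (ltnW Vn) n0.
Qed.

Lemma prodw_ext (m d : nat) (B : 'I_m -> 'M[R]_d) (x y : nat -> 'I_m) n :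
  (forall k, (k < n)%N -> x k = y k) -> prodw B x n = prodw B y n.
Proof.
by elim: n => //= n IH H; rewrite H // IH // => k kn; rewrite H // ltnW.
Qed.

Lemma prods_prodw (m d : nat) (B : 'I_m -> 'M[R]_d) (i0 : 'I_m) (s : seq 'I_m) :
  prods B s = prodw B (nth i0 (rev s)) (size s).
Proof.
elim: s => //= i s ->; rewrite rev_cons nth_rcons size_rev ltnn eqxx; congr (_ *m _).
by apply: prodw_ext => k ks; rewrite nth_rcons size_rev ks.
Qed.

Lemma opnorm_ge0 d (A : 'M[R]_d) : (0 < d)%N -> 0 <= opnorm A.
Proof. by move=> d0; apply: le_trans (entry_le_opnorm A (Ordinal d0) (Ordinal d0)). Qed.

Lemma jsr_eq1 (m d : nat) (B : 'I_m -> 'M[R]_d) (z : nat -> 'I_m) (c C : R) :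
  (0 < d)%N -> 0 < c ->
  (forall x n, (0 < n)%N -> opnorm (prodw B x n) <= C) ->
  (forall n, (0 < n)%N -> c <= opnorm (prodw B z n)) -> jsr B = 1.
Proof.
move=> d0 c0 HC Hc.
suff : jsr_term B @ \oo --> (1 : R) by move=> h; apply: (@cvg_lim R^o) h.
have C0 : 0 < C by apply: lt_le_trans (HC z 1%N isT); apply: lt_le_trans (Hc 1%N isT).
apply: squeeze_cvgr; [|exact: (cvg_root c0)|exact: (cvg_root C0)].
near=> n.
have n0 : (0 < n)%N by near: n; exists 1%N.
have mono (u v : R) : 0 <= u -> u <= v -> u `^ n%:R^-1 <= v `^ n%:R^-1.
  by move=> u0 uv; apply: ge0_ler_powR; rewrite ?nnegrE ?invr_ge0 ?ler0n ?(le_trans u0).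
apply/andP; split.
  (* [prods] puts the first letter leftmost and [prodw] the latest one, hence the reversal. *)
  pose t : n.-tuple 'I_m := [tuple of rev [tuple z i | i < n]].
  have -> : c `^ n%:R^-1 <= jsr_term B n; last by [].
  apply: le_trans (le_bigmax _ _ t); apply: mono; first exact: ltW.
  rewrite (prods_prodw _ (z 0%N)) size_tuple revK.
  rewrite (@prodw_ext _ _ _ _ z) ?Hc // => k kn.
  by rewrite -(tnth_nth _ _ (Ordinal kn)) tnth_mktuple.
apply: bigmax_le => [|t _]; first exact: powR_ge0.
apply: mono; first exact: opnorm_ge0.
by rewrite (prods_prodw _ (z 0%N)) size_tuple HC.
Unshelve. all: by end_near. Qed.
End GrowthRates.

(** * Shears as 2 x 2 matrices *)

Section TwoByTwo.
Variable R : realType.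
Implicit Types (v : R * R) (M : 'M[R]_2).

Definition mact M v : R * R :=
  (M ord0 ord0 * v.1 + M ord0 (lift ord0 ord0) * v.2,
   M (lift ord0 ord0) ord0 * v.1 + M (lift ord0 ord0) (lift ord0 ord0) * v.2).

Definition shearmx (w : bool -> R) (b : bool) : 'M[R]_2 :=
  \matrix_(i, k) (w b * (if b then (k <= i)%N else (i <= k)%N)%:R).

Lemma mact_mul M M' v : mact (M *m M') v = mact M (mact M' v).
Proof.
by rewrite /mact /= !mxE !big_ord_recl !big_ord0 /= !addr0; congr pair; ring.
Qed.

Lemma mact1 v : mact 1%:M v = v.
Proof. by case: v => a b; rewrite /mact !mxE /= !mul0r !mul1r addr0 add0r. Qed.

Lemma mact_shearmx w b v : mact (shearmx w b) v = (w b * (shear b v).1, w b * (shear b v).2).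
Proof.
by case: v => a c; rewrite /mact /shear !mxE /=; case: b => /=; congr pair; ring.
Qed.

Lemma total_mact M : total M = mass (mact M (unit2 R)).
Proof.
by rewrite /total /mass /mact /= !big_ord_recl !big_ord0 /= !addr0 !mulr1.
Qed.
End TwoByTwo.

(** * Interleaved tracks and their joint contraction *)

Section Product.
Variables (R : realType) (p L : nat) (w : 'I_p -> bool -> R).
Hypothesis L0 : (0 < L)%N.
Hypothesis pL : (p <= L)%N.
Hypothesis w0 : forall j, positive_weights (w j).
Hypothesis adm : forall j, admissible (w j).
Hypothesis Tge1 : forall j n, 1 <= max_growth (w j) n (unit2 R).
Implicit Types (x : nat -> bool) (v : R * R) (j : 'I_p).

Definition tile (s : nat) (b : bool) j : 'M[R]_2 :=
  if s == j then shearmx (w j) b else 1%:M.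
Local Notation fac := (factor L tile).
Local Notation N j := (lim_growth (w j)).

Lemma factorD x s m n j :
  fac x s (m + n) j = fac (shift m x) (s + m) n j *m fac x s m j.
Proof.
elim: n => [|n IH]; first by rewrite addn0 mul1mx.
by rewrite addnS /= IH mulmxA -addnA.
Qed.

Lemma lim_growth_ge0 j v : cone v -> 0 <= N j v.
Proof.
move=> cv; apply: le_trans (lim_growth_lower (w0 j) (adm j) (Tge1 j) cv).
by rewrite mulr_ge0 ?mass_ge0 // ltW // coupling_gt0.
Qed.

Lemma cone_tile s b j v : cone v -> cone (mact (tile s b j) v).
Proof.
move=> cv; rewrite /tile; case: ifP => _; last by rewrite mact1.
rewrite mact_shearmx; have /andP[a c] := shear_cone b cv.
by rewrite /cone /= !mulr_ge0 // ltW //; exact: w0.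
Qed.

Lemma lim_growth_scale j (c : R) v : 0 <= c -> cone v -> N j (c * v.1, c * v.2) = c * N j v.
Proof.
case: v => a b c0 /andP[a0 b0]; exact: (lim_growth_homogeneous (w0 j) (adm j) (Tge1 j)).
Qed.

Lemma lim_growth_tile_le s b j v : cone v -> N j (mact (tile s b j) v) <= N j v.
Proof.
move=> cv; rewrite /tile; case: ifP => _; last by rewrite mact1.
by rewrite mact_shearmx lim_growth_scale ?(ltW (w0 _ _)) ?shear_cone // lim_growth_step_le.
Qed.

Lemma cone_factor x s n j v : cone v -> cone (mact (fac x s n j) v).
Proof.
by move=> cv; elim: n => [|n IH]; rewrite ?mact1 //= mact_mul; exact: cone_tile.
Qed.

Lemma lim_growth_factor_le x s n j v : cone v -> N j (mact (fac x s n j) v) <= N j v.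
Proof.
move=> cv; elim: n => [|n IH]; first by rewrite mact1.
by apply: le_trans IH; rewrite /= mact_mul; apply/lim_growth_tile_le/cone_factor.
Qed.

Lemma factor_block x s n j : (s %% L = 0)%N -> (n <= L)%N ->
  fac x s n j = if (j < n)%N then shearmx (w j) (x j) else 1%:M.
Proof.
move=> s0; elim: n => [//|n IH] nL.
rewrite /= IH ?(ltnW nL) // -modnDml s0 add0n modn_small // /tile.
have [->|nj] := eqVneq n j; first by rewrite ltnn mulmx1 ltnSn.
by rewrite mul1mx [in RHS]ltnS [in RHS]leq_eqVlt eq_sym (negPf nj).
Qed.

(** Each track reads one letter per period, so over whole periods its tensor factor is the weighted
    shear product along the subsequence of indices congruent to j. *)
Lemma factor_blocks x s k j v : (s %% L = 0)%N ->
  mact (fac x s (k * L) j) v =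
  (weight (w j) (fun i => x (i * L + j)%N) k * (orbit (fun i => x (i * L + j)%N) v k).1,
   weight (w j) (fun i => x (i * L + j)%N) k * (orbit (fun i => x (i * L + j)%N) v k).2).
Proof.
move=> s0; elim: k => [|k IH].
  by rewrite mul0n mact1 weight0 !mul1r -surjective_pairing.
rewrite mulSnr factorD mact_mul IH factor_block //; last by rewrite addnC modnMDl.
rewrite (leq_trans (ltn_ord j) pL) mact_shearmx weightSr /=.
set o := orbit _ _ _; set y := x _; rewrite /shift -/y /shear.
by case: y => /=; congr pair; ring.
Qed.

Lemma lim_growth_blocks x s k j v : (s %% L = 0)%N -> cone v ->
  N j (mact (fac x s (k * L) j) v) = weight (w j) (fun i => x (i * L + j)%N) k *
    N j (orbit (fun i => x (i * L + j)%N) v k).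
Proof.
by move=> s0 cv; rewrite factor_blocks // lim_growth_scale ?orbit_cone // ltW // weight_gt0.
Qed.

Lemma total_factor_le x s n j : total (fac x s n j) <=
  (coupling (w j))^-1 * N j (mact (fac x s n j) (unit2 R)).
Proof.
rewrite total_mact ler_pdivlMl ?coupling_gt0 //.
exact/lim_growth_lower/cone_factor/unit_cone.
Qed.

Lemma total_factor_ge0 x s n j : 0 <= total (fac x s n j).
Proof. by rewrite total_mact; apply/mass_ge0/cone_factor/unit_cone. Qed.

Lemma total_factor_bound x s n j :
  total (fac x s n j) <= (coupling (w j))^-1 * N j (unit2 R).
Proof.
apply: (le_trans (total_factor_le _ _ _ _)); rewrite ler_wpM2l ?invr_ge0 ?(ltW (coupling_gt0 (w0 j))) //.
exact/lim_growth_factor_le/unit_cone.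
Qed.

(** The norm of the factor never increases in time, so its value at the end of a later whole period,
    where optimality gives equality, bounds its value at time n from below. *)
Lemma total_factor_extremal (z : 'I_p -> nat -> bool) x n j :
  (forall n, ext (w j) (unit2 R) (z j) n) -> (forall i, x (i * L + j)%N = z j i) ->
  coupling (w j) * N j (unit2 R) <= total (fac x 0 n j).
Proof.
move=> ez xz; have uc := unit_cone R.
pose k := (n %/ L).+1.
have nk : (n <= k * L)%N by rewrite ltnW // ltn_ceil.
have E : N j (mact (fac x 0 (k * L) j) (unit2 R)) = N j (unit2 R).
  rewrite lim_growth_blocks ?mod0n //.
  rewrite (@weight_ext _ _ _ (z j)) // (@orbit_ext _ _ (z j)) //.
  by case: (ez k).
have : N j (unit2 R) <= N j (mact (fac x 0 n j) (unit2 R)).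
  rewrite -E -[in X in X <= _](subnKC nk) factorD mact_mul.
  exact/lim_growth_factor_le/cone_factor.
move=> h; rewrite -ler_pdivlMl ?coupling_gt0 //; apply: (le_trans h).
by rewrite total_mact lim_growth_upper // cone_factor.
Qed.

Variables (q : R) (K : nat).
Hypothesis q0 : 0 <= q.
Hypothesis dich : forall j x, (exists v, ext (w j) v (shift 1 x) K) \/
  forall v, cone v -> weight (w j) x K.+1 * N j (orbit x v K.+1) <= q * N j v.

(** The contracting track may change from block to block, so a constant is kept for each track and
    only their product is bounded by q^i. The offset [L - s] brings a clock started at s back to
    0. *)
Lemma contraction x (s : 'I_L) :
  (forall i, exists j, forall v,
     ~ ext (w j) v (shift 1 (fun k => x (L - s + i * (K.+1 * L) + (k * L + j))%N)) K) ->
  forall i, exists c : 'I_p -> R, [/\ forall j, 0 <= c j, \prod_j c j <= q ^+ i &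
    forall j v, cone v -> N j (mact (fac x s (L - s + i * (K.+1 * L)) j) v) <= c j * N j v].
Proof.
move=> bad; elim=> [|i [c [c0 cq cN]]].
  exists (fun=> 1); split=> [//||j v cv]; first by rewrite big1 ?expr0.
  by rewrite mul1r lim_growth_factor_le.
have [j0 bj0] := bad i.
exists (fun j => if j == j0 then q * c j else c j); split.
- by move=> j; case: ifP => _; rewrite ?mulr_ge0.
- rewrite (bigD1 j0) //= eqxx exprS -mulrA; apply: ler_wpM2l => //.
  apply: le_trans cq; rewrite [leRHS](bigD1 j0) //=; apply: ler_wpM2l => //.
  by rewrite le_eqVlt; apply/orP; left; apply/eqP; apply: eq_bigr => j /negPf ->.
move=> j v cv.
rewrite mulSn (addnC (K.+1 * L)%N) addnA factorD mact_mul.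
set t := (L - s + _)%N; set u := mact _ v.
have cu : cone u by exact: cone_factor.
have st : ((s + t) %% L = 0)%N.
  by rewrite /t addnA subnKC ?(ltnW (ltn_ord s)) // mulnA -mulSn modnMl.
have Nu := cN j v cv; rewrite -/t -/u in Nu.
rewrite lim_growth_blocks //; set y := fun k => _.
case: eqP => [jj|_]; last by apply: le_trans Nu; exact: lim_growth_word_le.
have [[v' ev]|H] := dich j y.
  by case: (bj0 v'); rewrite -jj.
by apply: (le_trans (H u cu)); rewrite -mulrA ler_wpM2l.
Qed.

Lemma contraction_bound x (s : 'I_L) :
  (forall i, exists j, forall v,
     ~ ext (w j) v (shift 1 (fun k => x (L - s + i * (K.+1 * L) + (k * L + j))%N)) K) ->
  forall n, \prod_j total (fac x s n j) <=
    (\prod_j ((coupling (w j))^-1 * N j (unit2 R))) * q ^+ ((n - L) %/ (K.+1 * L)).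
Proof.
move=> bad n; have uc := unit_cone R.
have P0 : 0 <= \prod_j ((coupling (w j))^-1 * N j (unit2 R)).
  by apply: prodr_ge0 => j _; rewrite mulr_ge0 ?invr_ge0 ?(ltW (coupling_gt0 (w0 j))) // lim_growth_ge0.
set i := (_ %/ _)%N; have [nL|Ln] := ltnP n L.
  have -> : i = 0%N by rewrite /i (eqP (ltnW nL)) div0n.
  rewrite expr0 mulr1; apply: ler_prod => j _.
  by rewrite total_factor_ge0 total_factor_bound.
have [c [c0 cq cN]] := contraction bad i.
have tn : (L - s + i * (K.+1 * L) <= n)%N.
  have h : (i * (K.+1 * L) <= n - L)%N by exact: leq_trunc_div.
  by apply: (leq_trans (leq_add (leq_subr s L) h)); rewrite subnKC.
apply: le_trans (ler_wpM2l P0 cq); rewrite -big_split /=; apply: ler_prod => j _.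
rewrite total_factor_ge0 /=; apply: (le_trans (total_factor_le _ _ _ _)).
rewrite -mulrA ler_wpM2l ?invr_ge0 ?(ltW (coupling_gt0 (w0 j))) // mulrC.
apply: le_trans (cN j _ uc); rewrite -{1}(subnKC tn) factorD mact_mul.
exact/lim_growth_factor_le/cone_factor.
Qed.
End Product.

(** * The theorem *)

Section Complexity.
Variables (m : nat) (x : infseq m) (n : nat).

Lemma complexity_ge (F : finType) (k : F -> nat) :
  (forall f g, (forall i, (i < n)%N -> x (k f + i)%N = x (k g + i)%N) -> f = g) ->
  (#|F| <= subword_complexity x n)%N.
Proof.
move=> H; pose word f : n.-tuple 'I_m := [tuple x (k f + i)%N | i < n].
have wI : injective word.
  move=> f g E; apply: H => i i_n.
  by have := congr1 (fun t => tnth t (Ordinal i_n)) E; rewrite !tnth_mktuple.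
rewrite -cardsT -(card_imset _ wI); apply: subset_leq_card.
apply/fintype.subsetP => _ /imsetP[f _ ->]; rewrite inE; apply/asboolP.
by exists (k f) => i; rewrite tnth_mktuple.
Qed.

Lemma complexity_le (T : finType) (code : nat -> T) :
  (forall k k', code k = code k' -> forall i, (i < n)%N -> x (k + i)%N = x (k' + i)%N) ->
  (subword_complexity x n <= #|T|)%N.
Proof.
move=> H; pose S := [set t : n.-tuple 'I_m | `[< exists k, forall i : 'I_n, tnth t i = x (k + i)%N >]]%SET.
have -> : subword_complexity x n = #|S| by apply: eq_card => t; rewrite [RHS]inE; exact: asboolb.
have /choice[k Hk] : forall t : n.-tuple 'I_m, exists k, t \in S ->
    forall i : 'I_n, tnth t i = x (k + i)%N.
  move=> t; have [|_] := boolP (t \in S); last by exists 0%N.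
  by rewrite inE => /asboolP[k Hk]; exists k.
rewrite -(@card_in_imset _ _ (code \o k)); first exact: max_card.
move=> t t' tS t'S /= /H E; apply: eq_from_tnth => i.
by rewrite (Hk t tS) (Hk t' t'S) E.
Qed.
End Complexity.

Definition bit (i : 'I_2) : bool := (0 < i)%N.
Definition unbit (b : bool) : 'I_2 := if b then lift ord0 ord0 else ord0.

Lemma unbitK b : bit (unbit b) = b. Proof. by case: b. Qed.

(** Stated from one letter on: the empty product is the full identity, whereas an embedded matrix
    vanishes on the padding. *)
Lemma prodw_embed (p L D : nat) (L0 : (0 < L)%N) (enc : 'I_L * {ffun 'I_p -> 'I_2} -> 'I_D)
  (G : nat -> bool -> 'I_p -> 'M[Rdefinitions.R]_2) (chk : nat -> bool -> Rdefinitions.R)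
  (x : infseq 2) n : injective enc ->
  prodw (fun i => embed enc (one_step G chk (bit i))) x n.+1 =
  embed enc (n_step G chk (bit \o x) n.+1).
Proof.
move=> encI; elim: n => [|n IH].
  rewrite /= mulmx1; congr embed; apply/funext => u; apply/funext => v.
  rewrite /one_step /n_step /validity big_ord1 /= addn0 (modn_small (ltn_ord v.1)).
  by congr (_ * _); apply: eq_bigr => j _; rewrite mulmx1.
rewrite [LHS]/= -/(prodw _ x n.+1) IH embed_mul //; congr embed.
by apply/funext => u; apply/funext => v; exact: (n_stepS L0 G chk (bit \o x)).
Qed.

Theorem theorem2 (p : nat) (hp : (1 <= p)%N) :
  exists B : 'I_2 -> 'M[Rdefinitions.R]_(2 ^ p * (2 ^ p.+1 - 1)),
    (forall x : infseq 2, very_weakly_extremal B x ->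
       forall n : nat, (1 <= n)%N ->
         ((n %/ 2 ^ p).+1 ^ p <= subword_complexity x n)%N /\
         (2 ^+ (p * p))^-1 * (n%:R) ^+ p < ((n %/ 2 ^ p).+1 ^ p)%:R :> Rdefinitions.R) /\
    (exists z : infseq 2, strongly_extremal B z /\
       forall n : nat, (1 <= n)%N ->
         (subword_complexity z n <= 2 ^ p * (ceil_div n (2 ^ p) + 2) ^ p)%N).
Proof.
pose R := Rdefinitions.R.
have pL : (p <= 2 ^ p)%N by rewrite ltnW // ltn_expl.
have L0 : (0 < 2 ^ p)%N by rewrite expn_gt0.
set D := (_ * _)%N; set L := (2 ^ p)%N in pL L0 *.
have D0 : (0 < D)%N.
  by rewrite muln_gt0 L0 subn_gt0 -{1}(expn0 2) ltn_exp2l.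
have [r [r01 ind]] := exists_independent R p.
have /choice[w Hw] : forall j, exists w : bool -> R, [/\ positive_weights w, admissible w,
    forall n, 1 <= max_growth w n (unit2 R) &
    forall v x n, ext w v x n -> `|(ones x n)%:R - n%:R * r j| <= 1].
  by move=> j; have /andP[? ?] := r01 j; exact: exists_calibrated.
have w0 j : positive_weights (w j) by case: (Hw j).
have adm j : admissible (w j) by case: (Hw j).
have Tge1 j : forall n, 1 <= max_growth (w j) n (unit2 R) by case: (Hw j).
have freq j v x n : ext (w j) v x n -> `|(ones x n)%:R - n%:R * r j| <= 1.
  by case: (Hw j) => _ _ _; apply.
pose X := ('I_L * {ffun 'I_p -> 'I_2})%type.
(* The clock and the tensor factors use 2^p * 2^p states, which fit because 2^p <= 2^(p+1) - 1. *)
have cX : (#|{: X}| <= D)%N.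
  rewrite card_prod card_ffun !card_ord -/L leq_mul2l; apply/orP; right.
  by rewrite /L expnS; have := L0; rewrite /L; lia.
pose enc (u : X) : 'I_D := widen_ord cX (enum_rank u).
have encI : injective enc.
  by move=> u v /(congr1 val) /= /val_inj/enum_rank_inj.
pose G := tile w.
pose chk (s : nat) (b : bool) : R := ((s < p)%N || ~~ b)%:R.
pose B (i : 'I_2) : 'M[R]_D := embed enc (one_step G chk (bit i)).
pose y (x : infseq 2) : nat -> bool := bit \o x.
(* The sum of the entries of the product, split according to the initial clock value s. *)
pose S (x : infseq 2) n : R := \sum_(s < L) validity L chk (y x) s n *
  \prod_j total (factor L G (y x) s n j).
have V01 x s n : 0 <= validity L chk x s n <= 1.
  rewrite /validity prodr_ge0 => [|t _]; last by rewrite ler0n.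
  by apply: prodr_ile1 => t _; rewrite ler0n lern1 leq_b1.
have tot0 x s n j : 0 <= total (factor L G x s n j) by exact: total_factor_ge0.
have prod0 x s n : 0 <= \prod_j total (factor L G x s n j) by exact: prodr_ge0.
have fac0 x s n j i k : 0 <= factor L G x s n j i k.
  elim: n i k => [|n IH] i k; first by rewrite mxE ler0n.
  rewrite mxE; apply: sumr_ge0 => l _; rewrite mulr_ge0 //.
  by rewrite /G /tile; case: ifP => _; rewrite mxE ?ler0n // mulr_ge0 ?ler0n // ltW // w0.
have nstep0 x n (u v : X) : 0 <= n_step G chk x n u v.
  have /andP[V0 _] := V01 x v.1 n.
  rewrite /n_step; apply: mulr_ge0; first by apply: mulr_ge0; [exact: ler0n | exact: V0].
  by apply: prodr_ge0 => j _; exact: fac0.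
have sumB x n : \sum_i \sum_k prodw B x n.+1 i k = S x n.+1.
  by rewrite prodw_embed // sum_embed (sum_n_step L0).
have op_le x n : (0 < n)%N -> opnorm (prodw B x n) <= S x n.
  case: n => // n _; apply: (le_trans (opnorm_le_sum _)); rewrite -sumB.
  apply: ler_sum => i _; apply: ler_sum => k _.
  rewrite ger0_norm // prodw_embed // mxE; apply: sumr_ge0 => u _.
  by apply: sumr_ge0 => v _.
have op_ge x n : (0 < n)%N -> S x n <= (D * D)%:R * opnorm (prodw B x n).
  by case: n => // n _; rewrite -sumB; exact: sum_le_opnorm.
have S_le x n : S x n <= \sum_(s < L) \prod_j total (factor L G (y x) s n j).
  apply: ler_sum => s _; rewrite ler_piMl //.
  by case/andP: (V01 (y x) s n).
pose C : R := \prod_j ((coupling (w j))^-1 * lim_growth (w j) (unit2 R)).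
have S_bound x n : S x n <= L%:R * C.
  apply: (le_trans (S_le x n)).
  have -> : L%:R * C = \sum_(s < L) C by rewrite sumr_const card_ord mulr_natl.
  by apply: ler_sum => s _; apply: ler_prod => j _; rewrite tot0 total_factor_bound.
have /choice[zc Hzc] : forall j, exists z : nat -> bool, forall n, ext (w j) (unit2 R) z n.
  by move=> j; exact: ext_infinite.
pose z : infseq 2 := fun t => if (insub (t %% L)%N : option 'I_p) is Some j
  then unbit (zc j (t %/ L)%N)
  else ord0.
have zE i (j : 'I_p) : y z (i * L + j)%N = zc j i.
  have jL : (j < L)%N by exact: leq_trans (ltn_ord j) pL.
  rewrite /y /z /= modnMDl modn_small // divnMDl // divn_small // addn0.
  by rewrite (valK j) unbitK.
pose c : R := \prod_j (coupling (w j) * lim_growth (w j) (unit2 R)).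
have c0 : 0 < c.
  apply: prodr_gt0 => j _; rewrite mulr_gt0 ?coupling_gt0 //.
  by case: (interiorP (w0 j) (adm j) (Tge1 j) (unit_interior R)).
have Vz n : validity L chk (y z) 0 n = 1.
  rewrite /validity big1 // => t _; rewrite /chk /y /z /= add0n.
  by case: insubP => [j -> _|/negPf ->].
have Sz n : c <= S z n.
  rewrite /S (bigD1 (Ordinal L0)) //= Vz mul1r.
  apply: (@le_trans _ _ (\prod_j total (factor L G (y z) 0 n j))).
    apply: ler_prod => j _; rewrite mulr_ge0 ?(ltW (coupling_gt0 (w0 j))) ?lim_growth_ge0 ?unit_cone //=.
    exact: (total_factor_extremal L0 pL w0 adm Tge1 n (Hzc j) (fun i => zE i j)).
  rewrite lerDl; apply: sumr_ge0 => s _; rewrite mulr_ge0 //.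
  by case/andP: (V01 (y z) s n).
have DD0 : 0 < (D * D)%:R :> R by rewrite ltr0n muln_gt0 D0.
have opz n : (0 < n)%N -> c / (D * D)%:R <= opnorm (prodw B z n).
  by move=> n0; rewrite ler_pdivrMr // mulrC; apply: le_trans (op_ge z n n0).
have jsr1 : jsr B = 1.
  apply: (jsr_eq1 (z := z) (c := c / (D * D)%:R) (C := L%:R * C)) => //.
    by rewrite divr_gt0.
  by move=> x n n0; apply: le_trans (op_le x n n0) (S_bound x n).
exists B; split; last first.
  exists z; split.
    exists (c / (D * D)%:R); first by rewrite divr_gt0.
    by move=> n n0; rewrite jsr1 expr1n mulr1 opz.
  (* A window of length n meets at most m = ceil(n / L) + 1 periods, wherever it starts. With m + 1
     ranks per track and L residues of the starting point, the code takes L (m + 1)^p values. *)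
  move=> n n1; pose m := (ceil_div n L).+1.
  have nm : (n + L <= m * L)%N.
    rewrite /m /ceil_div mulSn addnC leq_add2l.
    have := ltn_ceil (n + L.-1) L0; rewrite mulSn; lia.
  have /choice[rho Hrho] : forall j, exists rho : nat -> 'I_m.+1, forall k k', rho k = rho k' ->
      forall i, (i < m)%N -> zc j (k + i)%N = zc j (k' + i)%N.
    by move=> j; exact: (factor_rank m (w0 j) (adm j) (Tge1 j) (Hzc j)).
  pose code k : 'I_L * {ffun 'I_p -> 'I_m.+1} :=
    (Ordinal (ltn_pmod k L0), [ffun j => rho j (k %/ L)%N]).
  have -> : (L * (ceil_div n L + 2) ^ p)%N = #|{: 'I_L * {ffun 'I_p -> 'I_m.+1}}|.
    by rewrite card_prod card_ffun !card_ord addn2.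
  apply: (@complexity_le _ _ _ _ code) => k k' [kk /ffunP E] i i_n.
  have D1 l : ((l + i) %/ L)%N = (l %/ L + (l %% L + i) %/ L)%N.
    by rewrite {1}(divn_eq l L) -addnA divnMDl.
  have e1 : ((k + i) %% L = (k' + i) %% L)%N by rewrite -modnDml kk modnDml.
  have zval t : z t = if (insub (t %% L)%N : option 'I_p) is Some j
    then unbit (zc j (t %/ L)%N) else ord0 by [].
  rewrite (zval (k + i)%N) (zval (k' + i)%N) e1 (D1 k) (D1 k') kk.
  case: insubP => // j _ _; congr unbit; apply: Hrho.
    by have := E j; rewrite !ffunE.
  rewrite ltn_divLR //; apply: leq_trans nm; rewrite addnC -addSn leq_add //.
  by rewrite ltnW // ltn_pmod.
move=> x vwe n n1; split; last first.
  rewrite mulrC ltr_pdivrMr ?exprn_gt0 // -!natrX -natrM ltr_nat.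
  by rewrite expnM -expnMn ltn_exp2r // ltn_ceil.
(* A window of length n that starts with a period shows at least floor(n / L) letters of every
   track. *)
have [K HK] := factor_separation (n %/ L) ind.
have /choice[q Hq] : forall j, exists q : R, [/\ 0 < q, q < 1 & forall x,
    (exists v, ext (w j) v (shift 1 x) K) \/
    forall v, cone v -> weight (w j) x K.+1 * lim_growth (w j) (orbit x v K.+1) <= q * lim_growth (w j) v].
  by move=> j; exact: uniform_dichotomy.
pose Q := \big[Num.max/2^-1]_j q j.
have Q0 : 0 < Q by apply: (@lt_le_trans _ _ 2^-1); [rewrite invr_gt0 | exact: bigmax_ge_id].
have Q1 : Q < 1.
  by apply/bigmax_ltP; split=> [|j _]; [rewrite invf_lt1 ?ltr1n | case: (Hq j)].
have dich j x' : (exists v, ext (w j) v (shift 1 x') K) \/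
    forall v, cone v -> weight (w j) x' K.+1 * lim_growth (w j) (orbit x' v K.+1) <= Q * lim_growth (w j) v.
  have [_ _ /(_ x')[e|H]] := Hq j; [by left | right => v cv].
  apply: le_trans (H v cv) _; apply: ler_wpM2r; first exact: lim_growth_ge0.
  exact: le_bigmax.
pose M := (K.+1 * L)%N.
pose win (s : 'I_L) i (j : 'I_p) k := y x (L - s + i * M + (k * L + j))%N.
have [[s [i good]]|bad] := pselect (exists (s : 'I_L) i, forall j, exists v,
    ext (w j) v (shift 1 (win s i j)) K).
  have [j a m aK|k [_ Hk]] := HK (fun j => shift 1 (win s i j)).
    have [v ev] := good j.
    have := ext_prefix (w0 j) (adm j) (Tge1 j) aK ev.
    by case/(ext_split (w0 j) (adm j) (Tge1 j)) => _; exact: freq.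
  rewrite -[X in (X <= _)%N](_ : #|{ffun 'I_p -> 'I_(n %/ L).+1}| = _); last first.
    by rewrite card_ffun !card_ord.
  (* The successor on [k f] skips the first period of the block, whose letters precede the optimal
     words. *)
  apply: (@complexity_ge _ _ _ _ (fun f => L - s + i * M + (k f).+1 * L)%N) => f g E.
  apply: Hk => j l l_n; rewrite /win /shift /y /=; congr bit.
  have ll : (l * L + j < n)%N.
    apply: (@leq_trans (l.+1 * L)%N); first by rewrite mulSnr ltn_add2l (leq_trans _ pL).
    by apply: leq_trans (leq_trunc_div n L); rewrite leq_mul2r l_n orbT.
  have P f' : (L - s + i * M + ((1 + (k f' + l)) * L + j) =
      L - s + i * M + (k f').+1 * L + (l * L + j))%N.
    by rewrite add1n -addSn mulnDl -!addnA.
  by rewrite !P E.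
have lt1 : (limn_esup (fun n => (opnorm (prodw B x n) `^ (n%:R)^-1)%:E) < 1)%E.
  apply: (@limn_esup_root_lt1 _ (L%:R * C) Q L M) => //.
  - by move=> n'; exact: opnorm_ge0.
  - by rewrite muln_gt0.
  move=> n' n'0; apply: (le_trans (op_le x n' n'0)); apply: (le_trans (S_le x n')).
  have -> : L%:R * C * Q ^+ ((n' - L) %/ M) = \sum_(s < L) (C * Q ^+ ((n' - L) %/ M)).
    by rewrite sumr_const card_ord -mulrA mulr_natl.
  apply: ler_sum => s _; apply: (contraction_bound pL w0 adm Tge1 (ltW Q0) dich) => i.
  apply: contrapT => H; apply: bad; exists s, i => j.
  apply: contrapT => h; apply: H; exists j => v ev; apply: h; by exists v.
by move: vwe lt1; rewrite /very_weakly_extremal jsr1 => ->; rewrite ltxx.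
Qed.
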